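(* Let $n\geq 1$. For all $i,j,k,l\in[1,n]$, the quantities $c^{k,l}_{i,j}$ (defined in the context for $\mathrm{Gr}(1,n)=\mathbb{P}^{n-1}$) satisfy: 1. $c^{k,l}_{i,j}=0$ unless $k\le l\le i$ and $l\le j$; 2. when $k<i$ and $k\le l\le i\le j$, $$c^{k,l}_{i,j}=\begin{cases}\mathrm{Res}_{z=0}\left(\dfrac{h^2(z+h)^{i+j-k-3}}{z^{i+j-k-n+1}}\right)&\text{if }l=k,\\[2mm] \mathrm{Res}_{z=0}\left(\dfrac{h^3(z+h)^{i+j+k-2l-3}(z+2h)^{l-k-1}}{z^{i+j-l-n+1}}\right)&\text{if }k<l<i,\\[2mm] \mathrm{Res}_{z=0}\left(\dfrac{h^{2-\delta_{i,j}}(z+h)^{k-1+(j-i-1)(1-\delta_{i,j})}(z+2h)^{i-k-1}}{z^{j-n+1}}\right)&\text{if }l=i;\end{cases}$$ 3. when $k=l=i\le j$, $c^{i,i}_{i,j}=h^{n-1}$ if $j=n$, and $c^{i,i}_{i,j}=0$ otherwise.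
   Context: $[1,n]=\{1,\dots,n\}$, $\delta_{i,j}$ is the Kronecker delta, and $h$ is a formal parameter (treated as a constant in integrals and residues). For $1\le i\le n$ set (the cohomological weight functions of $\mathrm{Gr}(1,n)$) $$W_{\mathrm{id},i}(t)=\prod_{b<i}(z_b-t+h)\prod_{b>i}(z_b-t),\qquad W_{s_0,i}(t)=\prod_{b>i}(z_b-t+h)\prod_{b<i}(z_b-t),$$ where $b$ ranges in $[1,n]$ and $t,z_1,\dots,z_n$ are variables. For $i,j,k,l\in[1,n]$ define the rational function $$\hat c^{k,l}_{i,j}=\frac{W_{\mathrm{id},i}(z_l)\,W_{\mathrm{id},j}(z_l)\,W_{s_0,k}(z_l)}{\prod_{b\ne l}(z_b-z_l)\prod_{b\neq l}(z_b-z_l+h)}.$$ (The sums $\sum_l\hat c^{k,l}_{i,j}$ are the torus-equivariant structure constants of $\mathbb{P}^{n-1}$ for the basis of CSM classes of Schubert cells.) For $1\le b\le n$ let $\gamma_b\subset\mathbb{C}$ be the counterclockwise circle centered at $0$ of radius $1/(b+1)$, and define $$c^{k,l}_{i,j}=\left(\frac{1}{2\pi\sqrt{-1}}\right)^n\int_{\gamma_n}\cdots\int_{\gamma_1}\frac{\hat c^{k,l}_{i,j}}{z_1\cdots z_n}\,dz_1\cdots dz_n ,$$ where $\hat c^{k,l}_{i,j}$ is taken in fully cancelled (reduced) form. *)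

(* Defs.v *)
From HB Require Import structures.
From mathcomp Require Import all_boot all_order all_algebra.
From mathcomp Require Import complex.
From mathcomp Require Import all_classical all_reals all_analysis.
From mathcomp Require Import -(notations) mpoly.

Set Implicit Arguments.
Unset Strict Implicit.
Unset Printing Implicit Defensive.

Import Order.TTheory GRing.Theory Num.Theory.
Import numFieldNormedType.Exports.

Local Open Scope ring_scope.

(* C[h, z_1, ..., z_n]: the variable of index 0 is the formal parameter h and
   the variable of index b, for 1 <= b <= n, is z_b. *)
Definition hzpoly (R : realType) (n : nat) := mpoly n.+1 R[i].

Definition hvar (R : realType) (n : nat) : hzpoly R n :=
  mpolyX R[i] (mnm1 ord0).

Definition zvar (R : realType) (n : nat) (b : nat) : hzpoly R n :=
  mpolyX R[i] (mnm1 (inord b)).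

Definition W_id (R : realType) (n i : nat) (t : hzpoly R n) : hzpoly R n :=
  (\prod_(1 <= b < n.+1 | (b < i)%N) (zvar R n b - t + hvar R n)) *
  (\prod_(1 <= b < n.+1 | (i < b)%N) (zvar R n b - t)).

Definition W_s0 (R : realType) (n i : nat) (t : hzpoly R n) : hzpoly R n :=
  (\prod_(1 <= b < n.+1 | (i < b)%N) (zvar R n b - t + hvar R n)) *
  (\prod_(1 <= b < n.+1 | (b < i)%N) (zvar R n b - t)).

Definition chat (R : realType) (n i j k l : nat) : {fraction (hzpoly R n)} :=
  tofrac (W_id i (zvar R n l) * W_id j (zvar R n l) * W_s0 k (zvar R n l)) /
  tofrac ((\prod_(1 <= b < n.+1 | b != l) (zvar R n b - zvar R n l)) *
          (\prod_(1 <= b < n.+1 | b != l)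
             (zvar R n b - zvar R n l + hvar R n))).

Definition reduced_form (A : idomainType) (f : {fraction A}) (pq : A * A) :=
  [/\ pq.2 != 0,
      f = tofrac pq.1 / tofrac pq.2
    & forall d p q : A, pq.1 = d * p -> pq.2 = d * q -> d \is a GRing.unit].

(* The value of a rational function at a point is read off a fully cancelled
   numerator / denominator pair; such a pair is unique up to a nonzero
   constant, so the value does not depend on the choice made by xget. *)
Definition fraction_eval (R : realType) (n : nat)
    (f : {fraction (hzpoly R n)}) (v : 'I_n.+1 -> R[i]) : R[i] :=
  let pq := xget (0, 1) [set pq | reduced_form f pq]%classic in
  meval v pq.1 / meval v pq.2.

(* z b is the value of z_b, for 1 <= b <= n; z 0 is not used. *)
Definition hzpoint (R : realType) (n : nat) (h : R[i]) (z : nat -> R[i]) :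
    'I_n.+1 -> R[i] :=
  fun a => if a == ord0 then h else z a.

Definition circle_integral (R : realType) (r : R) (f : R[i] -> R[i]) : R[i] :=
  let gamma (t : R) : R[i] := ((r * cos t) +i* (r * sin t))%C in
  let g (t : R) : R[i] := f (gamma t) * ('i%C * gamma t) in
  ((\int[lebesgue_measure]_(t in `[0, 2 * pi]%classic) complex.Re (g t))
   +i* (\int[lebesgue_measure]_(t in `[0, 2 * pi]%classic) complex.Im (g t)))%C.

(* Integral of F over z_m in gamma_m (outermost), ..., z_1 in gamma_1
   (innermost), the other coordinates being those of z. *)
Fixpoint torus_integral (R : realType) (m : nat)
    (F : (nat -> R[i]) -> R[i]) (z : nat -> R[i]) : R[i] :=
  if m is m'.+1 then
    circle_integral ((m.+1)%:R^-1) (fun w : R[i] =>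
      torus_integral m' F (fun b => if b == m then w else z b))
  else F z.

(* c^{k,l}_{i,j}, as a function of the value h of the formal parameter. *)
Definition ccoef (R : realType) (n i j k l : nat) (h : R[i]) : R[i] :=
  (2 * (pi : R)%:C%C * 'i%C)^-1 ^+ n *
  torus_integral n
    (fun z => fraction_eval (chat R n i j k l) (hzpoint h z) /
              \prod_(1 <= b < n.+1) z b)
    (fun=> 0).

(* r is the residue of f at z0: the coefficient of (z - z0)^-1 in the Laurent
   expansion of f on a punctured disc around z0.  R[i]^o carries the topology
   of the complex plane. *)
Definition is_residue (R : realType) (f : R[i] -> R[i]) (z0 r : R[i]) : Prop :=
  exists (a : int -> R[i]) (e : R),
    [/\ 0 < e,
        forall z : R[i], 0 < `|z - z0| < e%:C%C ->
          exists s t : R[i]^o,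
            [/\ (series (fun m : nat => a m%:Z * (z - z0) ^+ m : R[i]^o)
                   @ \oo --> s)%classic,
                (series (fun m : nat =>
                           a (- m.+1%:Z) * (z - z0) ^- m.+1 : R[i]^o)
                   @ \oo --> t)%classic
              & f z = s + t]
      & r = a (- 1)].

(* Main.v *)
Require Import Defs.
From HB Require Import structures.
From mathcomp Require Import all_boot all_order all_algebra.
From mathcomp Require Import complex.
From mathcomp Require Import all_classical all_reals all_analysis.
From mathcomp Require Import -(notations) mpoly.
From mathcomp Require Import zify ring lra.

Set Implicit Arguments.
Unset Strict Implicit.
Unset Printing Implicit Defensive.

Import Order.TTheory GRing.Theory Num.Theory.
Import numFieldNormedType.Exports.
Local Open Scope ring_scope.

(** After cancellation the rational function whose torus integral is
    ccoef n i j k l h, for k <= l <= i <= j, is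
      h^e * prod_(b <> l) f_b(z_b - z_l),
    where every f_b(x) is a product of powers of x + h and of x and has at most
    a simple pole, so that f_b(x) = al_b x + be_b + ga_b / x
    ([fraction_eval_chat], [chat_factor_laurent]).  Unless k <= l <= i and l <= j,
    one of the three weight functions vanishes at z_l and the integrand is 0.

    With the measure dz_b / z_b, the torus integral divided by (2 pi i)^n is an
    iterated mean over circles centred at 0.  Only the position of the pole
    z_b = z_l with respect to the circle of z_b matters, and this is what the
    strictly decreasing radii decide.  Writing y = - z_l, the mean of
    f_b(z_b - z_l) over z_b is al_b y + be_b when b < l, where z_l lies inside
    the circle, and al_b y + be_b + ga_b / y when l < b, where it lies outside:
    expand 1 / (z_b - z_l) in a geometric series and use that every nonzero power
    of z_b has mean 0 ([cmean_series], [cmean_inv_inside], [cmean_cauchy]).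
    The variables with l < b are integrated after z_l; [cmean_cauchy] is stated
    so that it also exchanges the two means, and [torus_integral_central] applies
    it once for each of these variables.

    The means of the factors are again products of powers
    ([chat_factor_mean]): b < k gives y + h, k < b < l gives y + 2h,
    l < b < i gives (y + h)^2 / y, and so on.  Multiplying them,
      ccoef n i j k l h = mean over z_l of Q(y) / y^(i - l)
    for a polynomial Q ([ccoef_poly]), which is the coefficient of y^(i - l) in Q
    ([ccoefE]), that is, the residue at 0 of Q(y) / y^(i - l + 1)
    ([is_residue_poly]).  The three residues of the statement are the cases
    l = k, k < l < i and l = i of this formula, and its last part is the case
    k = l = i.

    The values of chat are read off an arbitrary reduced fraction.  The
    denominator prod (z_b - z_l) is a product of prime elements that do not divide
    the numerator, hence this fraction is reduced and every reduced form agrees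
    with it up to a unit ([reduced_form_prod], [reduced_form_prod_unique]). *)

(** * Reduced fractions whose denominator is a product of primes *)

Definition prime_elt (A : idomainType) (x : A) : Prop :=
  x != 0 /\ forall a b c : A, a * b = x * c ->
    (exists a', a = x * a') \/ (exists b', b = x * b').

(** The primes of s are moved one by one from the left-hand side to q: each
    divides N * q but not N. *)
Lemma prime_prod_split (A : idomainType) (s : seq A) (N p q : A) :
    (forall x, x \in s -> prime_elt x /\ ~ exists y, N = x * y) ->
    p * \prod_(x <- s) x = N * q ->
  exists2 u, p = N * u & q = (\prod_(x <- s) x) * u.
Proof.
elim: s p q => [|x s IHs] p q hs.
  by rewrite big_nil mulr1 => ->; exists q => //; rewrite mul1r.
rewrite big_cons => hpq; have [[x0 xprime] xN] := hs x (mem_head x s).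
have : N * q = x * (p * \prod_(y <- s) y) by rewrite -hpq; ring.
move=> /xprime[//|[q' hq]].
have hpq' : p * \prod_(y <- s) y = N * q'.
  by apply: (mulfI x0); rewrite mulrCA hpq hq; ring.
have [y ys|u -> hq'] := IHs p q' _ hpq'; first by apply: hs;
  rewrite inE ys orbT.
by exists u; rewrite // hq hq'; ring.
Qed.

Lemma reduced_form_prod (A : idomainType) (s : seq A) (N : A) :
    (forall x, x \in s -> prime_elt x /\ ~ exists y, N = x * y) ->
  reduced_form (tofrac N / tofrac (\prod_(x <- s) x)) (N, \prod_(x <- s) x).
Proof.
move=> hs; have D0 : \prod_(x <- s) x != 0.
  by rewrite prodf_seq_neq0; apply/allP => x /hs[[]].
split=> //= d p q hN hD.
have [|u _ hq] := @prime_prod_split A s N p q hs; first by rewrite hN hD; ring.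
apply/unitrPr; exists u; apply: (mulIf D0).
by rewrite mul1r [in RHS]hD hq; ring.
Qed.

Lemma reduced_form_prod_unique (A : idomainType) (s : seq A) (N : A) (pq :
  A * A) :
    (forall x, x \in s -> prime_elt x /\ ~ exists y, N = x * y) ->
    reduced_form (tofrac N / tofrac (\prod_(x <- s) x)) pq ->
  exists2 u, u \is a GRing.unit &
    pq = (N * u, (\prod_(x <- s) x) * u).
Proof.
case: pq => p q hs [/= q0 hf hpq].
have D0 : \prod_(x <- s) x != 0.
  by rewrite prodf_seq_neq0; apply/allP => x /hs[[]].
have [|u hp hq] := @prime_prod_split A s N p q hs.
  apply/eqP; rewrite -tofrac_eq !rmorphM /=.
  move/eqP: hf; rewrite eqr_div ?tofrac_eq0 // => /eqP hf.
  by rewrite hf mulrC.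
exists u; last by rewrite hp hq.
by apply: (hpq u N (\prod_(x <- s) x)); rewrite 1?mulrC.
Qed.

(** The unit by which a reduced form may differ from the given one cancels in the
    quotient; when the denominator vanishes at v both sides are 0. *)
Lemma fraction_eval_prod (R : realType) (n : nat) (s : seq (hzpoly R n))
    (N : hzpoly R n) (v : 'I_n.+1 -> R[i]) :
    (forall x, x \in s -> prime_elt x /\ ~ exists y, N = x * y) ->
  fraction_eval (tofrac N / tofrac (\prod_(x <- s) x)) v =
    meval v N / meval v (\prod_(x <- s) x).
Proof.
move=> hs; rewrite /fraction_eval;
  case: xgetP => [pq _ /(reduced_form_prod_unique hs)|].
  move=> [u uunit -> /=]; rewrite !rmorphM /= -mulf_div divff ?mulr1//.
  by rewrite -unitfE rmorph_unit.
by move=> /(_ _ (reduced_form_prod hs)).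
Qed.

Lemma fraction_eval0 (R : realType) (n : nat) (v : 'I_n.+1 -> R[i]) :
  fraction_eval (0 : {fraction (hzpoly R n)}) v = 0.
Proof.
rewrite /fraction_eval; case: xgetP => [[p q] _ [/= q0 hf _]|_]; last first.
  by rewrite rmorph0 mul0r.
move/esym/eqP: hf; rewrite mulf_eq0 invr_eq0 !tofrac_eq0 (negPf q0) orbF.
by move=> /eqP ->; rewrite rmorph0 mul0r.
Qed.

(** * The differences of two variables are prime *)

(** Substituting X_c for X_a is a ring morphism into a domain that is congruent
    to the identity modulo X_a - X_c, hence has the multiples of X_a - X_c as
    kernel. *)
Section VarDiff.
Variables (K : fieldType) (n : nat) (a c : 'I_n).
Hypothesis ac : a != c.
Let X (b : 'I_n) : mpoly n K := mpolyX K (mnm1 b).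
Let x := X a - X c.
Let lq : n.-tuple (mpoly n K) := [tuple X (if b == a then c else b) | b < n].
Let S := comp_mpoly lq.

Lemma subst_varM (p q : mpoly n K) : S (p * q) = S p * S q.
Proof. exact: rmorphM. Qed.

Lemma subst_var_congr (p : mpoly n K) : exists q, p - S p = x * q.
Proof.
have congrM (p1 p2 : mpoly n K) : (exists q, p1 - S p1 = x * q) ->
    (exists q, p2 - S p2 = x * q) -> exists q, p1 * p2 - S (p1 * p2) = x * q.
  move=> [q1 h1] [q2 h2]; exists (q1 * p2 + S p1 * q2).
  rewrite mulrDr mulrA -h1 mulrCA -h2 subst_varM; ring.
have -> : S p = \sum_(m <- msupp p) S (mcoeff m p *: mpolyX K m).
  by rewrite {1}(mpolyE p) /S raddf_sum.
rewrite {1}(mpolyE p) -sumrB.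
elim/big_ind: _ => [|p1 p2 [q1 h1] [q2 h2]|m _].
- by exists 0; rewrite mulr0.
- by exists (q1 + q2); rewrite h1 h2 mulrDr.
rewrite /S comp_mpolyZ -scalerBr.
suff [q hq] : exists q, mpolyX K m - S (mpolyX K m) = x * q.
  by exists (mcoeff m p *: q); rewrite hq scalerAr.
rewrite mpolyXE_id; elim/big_ind: _ => [|p1 p2|b _]; last 2 first.
- exact: congrM.
- elim: (m b) => [|e IHe]; first by exists 0;
    rewrite /S comp_mpoly1 subrr mulr0.
  rewrite exprS; apply: congrM => //.
  rewrite /S comp_mpolyXU -tnth_nth tnth_mktuple.
  have [->|_] := eqVneq b a; first by exists 1; rewrite mulr1.
  by exists 0; rewrite subrr mulr0.
by exists 0; rewrite /S comp_mpoly1 subrr mulr0.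
Qed.

Lemma prime_elt_var_diff : prime_elt x.
Proof.
have Sx : S x = 0.
  rewrite /S raddfB /= !comp_mpolyXU -!tnth_nth !tnth_mktuple eqxx.
  by rewrite eq_sym (negPf ac) subrr.
split=> [|p q r hpq].
  apply/eqP => /(congr1 (meval (fun b : 'I_n => (b == a)%:R : K))).
  rewrite raddfB /= !mevalXU eqxx eq_sym (negPf ac) subr0 raddf0.
  by apply/eqP; rewrite oner_eq0.
have : S p * S q = 0 by rewrite -subst_varM hpq subst_varM Sx mul0r.
have [p' hp] := subst_var_congr p; have [q' hq] := subst_var_congr q.
move=> /eqP; rewrite mulf_eq0 => /orP[] /eqP h0; [left|right].
  by exists p'; rewrite -hp h0 subr0.
by exists q'; rewrite -hq h0 subr0.
Qed.
End VarDiff.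

(** * The structure constants as reduced fractions *)
Section Chat.
Variables (R : realType) (n l : nat).
Hypothesis hl : (1 <= l <= n)%N.
Let x b : hzpoly R n := zvar R n b - zvar R n l.
Let hh : hzpoly R n := hvar R n.

(** Turning the range conditions of the weight functions into 0-1 exponents makes
    all products range over the same set b <> l, so that they can be multiplied
    factor by factor. *)
Lemma prod_pred_split (V : comNzRingType) (P : nat -> bool) (F : nat -> V) :
  \prod_(1 <= b < n.+1 | P b) F b =
    F l ^+ P l * \prod_(1 <= b < n.+1 | b != l) F b ^+ P b.
Proof.
rewrite big_mkcond (bigD1_seq l) ?iota_uniq ?mem_index_iota//=.
have E b : (if P b then F b else 1) = F b ^+ P b by case: (P b).
by rewrite E; congr (_ * _); apply: eq_bigr.
Qed.

Lemma W_idE i : (l <= i)%N -> W_id i (zvar R n l) =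
  hh ^+ (l < i) *
  \prod_(1 <= b < n.+1 | b != l) ((x b + hh) ^+ (b < i) * x b ^+ (i < b)).
Proof.
move=> li; rewrite /W_id [X in X * _]prod_pred_split [X in _ *
  X]prod_pred_split subrr add0r [(i < l)%N]ltnNge li mul1r.
by rewrite -mulrA -big_split.
Qed.

Lemma W_s0E k : (k <= l)%N -> W_s0 k (zvar R n l) =
  hh ^+ (k < l) *
  \prod_(1 <= b < n.+1 | b != l) ((x b + hh) ^+ (k < b) * x b ^+ (b < k)).
Proof.
move=> kl; rewrite /W_s0 [X in X * _]prod_pred_split [X in _ *
  X]prod_pred_split subrr add0r [(l < k)%N]ltnNge kl mul1r.
by rewrite -mulrA -big_split.
Qed.

Lemma W_id_eq0 i : (i < l)%N -> W_id i (zvar R n l) = 0.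
Proof.
by move=> il; rewrite /W_id [X in _ * X]prod_pred_split il subrr expr1 mul0r
  mulr0.
Qed.

Lemma W_s0_eq0 k : (l < k)%N -> W_s0 k (zvar R n l) = 0.
Proof.
by move=> lk; rewrite /W_s0 [X in _ * X]prod_pred_split lk subrr expr1 mul0r
  mulr0.
Qed.

Lemma chat_eq0 i j k :
  ~ ((k <= l <= i)%N /\ (l <= j)%N) -> chat R n i j k l = 0.
Proof.
move=> hn; rewrite /chat; set W := W_id i _ * _ * _.
suff -> : W = 0 by rewrite rmorph0 mul0r.
rewrite /W; have [il|li] := ltnP i l; first by rewrite W_id_eq0// !mul0r.
have [jl|lj] := ltnP j l; first by rewrite (W_id_eq0 jl) mulr0 mul0r.
have [lk|kl] := ltnP l k; first by rewrite W_s0_eq0// mulr0.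
by case: hn; rewrite kl li lj.
Qed.
End Chat.

Section ChatEval.
Variables (R : realType) (n i j k l : nat).
Hypotheses (hl : (1 <= l <= n)%N) (kl : (k <= l)%N) (li : (l <= i)%N).
Hypothesis ij : (i <= j)%N.
Let x b : hzpoly R n := zvar R n b - zvar R n l.
Let hh : hzpoly R n := hvar R n.

(** The exponents hold for i <= j and b <> l: there x + h occurs
    [b < i] + [b < j] + [k < b] times in the numerator of chat, which is one more
    than here, and x occurs [i < b] + [j < b] + [b < k] times. *)
Definition chat_num (V : nzRingType) (h : V) (b : nat) (y : V) : V :=
  (y + h) ^+ ((b < j)%N + (k < b < i)%N) * y ^+ (j < b)%N.

Definition chat_factor (F : fieldType) (h : F) (b : nat) (y : F) : F :=
  chat_num h b y / y ^+ (k <= b <= i)%N.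

Lemma chat_num_cross (V : comNzRingType) (h y : V) b : b != l ->
  (y + h) ^+ (b < i) * y ^+ (i < b) * ((y + h) ^+ (b < j) * y ^+ (j < b)) *
  ((y + h) ^+ (k < b) * y ^+ (b < k)) * y ^+ (k <= b <= i)%N =
  chat_num h b y * (y * (y + h)).
Proof.
move=> bl; rewrite /chat_num; move: (y + h) => w.
transitivity (w ^+ ((b < i) + (b < j) + (k < b)) *
    y ^+ ((i < b) + (j < b) + (b < k) + (k <= b <= i)%N)).
  by rewrite !exprD; ring.
transitivity (w ^+ ((b < j) + (k < b < i)%N + 1) * y ^+ ((j < b) + 1)).
  congr (_ ^+ _ * _ ^+ _); lia.
by rewrite !exprD !expr1; ring.
Qed.

Lemma prod_cross (V : comNzRingType) (r : seq nat) (P : pred nat)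
    (A B C' D E F G : nat -> V) :
  (forall b, P b -> A b * B b * C' b * D b = E b * (F b * G b)) ->
  \prod_(b <- r | P b) A b * \prod_(b <- r | P b) B b *
    \prod_(b <- r | P b) C' b * \prod_(b <- r | P b) D b =
  \prod_(b <- r | P b) E b * (\prod_(b <- r | P b) F b * \prod_(b <- r | P b) G
    b).
Proof. by move=> ABE; rewrite -!big_split; exact: eq_bigr. Qed.

Lemma cross_factor (V : comNzRingType) (a b c A B C' D E F G : V) :
  A * B * C' * D = E * (F * G) ->
  a * A * (b * B) * (c * C') * D = a * b * c * E * (F * G).
Proof. by move=> H; rewrite -[RHS]mulrA -H; ring. Qed.

Let e := ((l < i)%N + (l < j)%N + (k < l)%N)%N.
Let s := [seq x b | b <- index_iota 1 n.+1 & (b != l) && (k <= b <= i)%N].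
Let N := hh ^+ e * \prod_(1 <= b < n.+1 | b != l) chat_num hh b (x b).

Lemma meval_hvar h (z : nat -> R[i]) : meval (hzpoint h z) hh = h.
Proof. by rewrite mevalXU /hzpoint eqxx. Qed.

Lemma meval_zvar h (z : nat -> R[i]) b : (1 <= b <= n)%N ->
  meval (hzpoint h z) (zvar R n b) = z b.
Proof.
move=> /andP[b1 bn]; rewrite mevalXU /hzpoint inordK//.
suff /negPf -> : inord b != ord0 :> 'I_n.+1 by [].
by rewrite -val_eqE /= inordK// -lt0n.
Qed.

Lemma meval_x h (z : nat -> R[i]) b : (1 <= b <= n)%N ->
  meval (hzpoint h z) (x b) = z b - z l.
Proof. by move=> hb; rewrite raddfB /= !meval_zvar. Qed.

Lemma meval_prod_x h (z : nat -> R[i]) (P : pred nat)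
    (F : nat -> hzpoly R n -> hzpoly R n) (G : nat -> R[i] -> R[i]) :
  (forall b y, meval (hzpoint h z) (F b y) = G b (meval (hzpoint h z) y)) ->
  meval (hzpoint h z) (\prod_(1 <= b < n.+1 | P b) F b (x b)) =
    \prod_(1 <= b < n.+1 | P b) G b (z b - z l).
Proof.
move=> FG; rewrite rmorph_prod [LHS]big_nat_cond [RHS]big_nat_cond.
by apply: eq_bigr => b /andP[hb _]; rewrite -(meval_x h z hb) -FG.
Qed.

Lemma meval_num h (z : nat -> R[i]) : meval (hzpoint h z) N =
  h ^+ e * \prod_(1 <= b < n.+1 | b != l) chat_num h b (z b - z l).
Proof.
rewrite rmorphM rmorphXn /= meval_hvar; congr (_ * _).
apply: meval_prod_x => b y.
by rewrite /chat_num rmorphM !rmorphXn rmorphD /= meval_hvar.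
Qed.

(** The right-hand side is reduced: the remaining denominators are the
    z_b - z_l with k <= b <= i, and the factors x_b of the numerator have
    j < b. *)
Lemma chatE : chat R n i j k l = tofrac N / tofrac (\prod_(y <- s) y).
Proof.
have sE : \prod_(y <- s) y =
    \prod_(1 <= b < n.+1 | b != l) x b ^+ (k <= b <= i)%N.
  rewrite big_map big_filter big_mkcondr /=; apply: eq_bigr => b _.
  by case: ifP.
(* all the factors are nonzero since none of them vanishes at this point *)
pose z (b : nat) : R[i] := (b != l)%:R.
have zl : z l = 0 by rewrite /z eqxx.
have zb b : b != l -> z b = 1 by rewrite /z => ->.
have neq0 (P : hzpoly R n) : meval (hzpoint 1 z) P != 0 -> P != 0.
  by apply: contra_neq => ->; rewrite raddf0.
have x0 b : (1 <= b <= n)%N -> b != l -> x b != 0.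
  by move=> hb bl; apply: neq0; rewrite meval_x// zb// zl subr0 oner_eq0.
have xh0 b : (1 <= b <= n)%N -> b != l -> x b + hh != 0.
  move=> hb bl; apply: neq0; rewrite rmorphD /= meval_x// meval_hvar zb// zl.
  by rewrite subr0 -[1 + 1]/2%:R pnatr_eq0.
have prod0 (F : nat -> hzpoly R n) :
    (forall b, (1 <= b <= n)%N -> b != l -> F b != 0) ->
    \prod_(1 <= b < n.+1 | b != l) F b != 0.
  move=> F0; rewrite prodf_seq_neq0; apply/allP => b.
  by rewrite mem_index_iota => hb; apply/implyP => bl; apply: F0.
apply/eqP; rewrite /chat eqr_div ?tofrac_eq0 ?sE ?mulf_neq0 ?prod0//;
  last first.
  by move=> b hb bl; rewrite expf_neq0// x0.
rewrite -!rmorphM tofrac_eq /N (W_idE _ hl li) (W_idE _ hl (leq_trans li ij))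
  (W_s0E _ hl kl).
apply/eqP; rewrite /e 2!exprD; apply: cross_factor.
by apply: prod_cross => b bl; exact: chat_num_cross.
Qed.

Lemma fraction_eval_chat h (z : nat -> R[i]) :
  fraction_eval (chat R n i j k l) (hzpoint h z) =
    h ^+ e * \prod_(1 <= b < n.+1 | b != l) chat_factor h b (z b - z l).
Proof.
rewrite chatE fraction_eval_prod; last first.
  move=> y /mapP[b]; rewrite mem_filter mem_index_iota.
  move=> /andP[/andP[bl kbi] hb] -> {y}; split.
    apply: prime_elt_var_diff; have [[_ ln] [_ bn]] := (andP hl, andP hb).
    by rewrite -val_eqE /= !inordK.
  (* this point annihilates z_b - z_l and no factor of the numerator *)
  move=> [q] /(congr1 (meval (hzpoint 1 (fun c => ((c != l) && (c != b))%:R)))).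
  rewrite meval_num rmorphM /= (meval_x _ _ hb) !eqxx andbF subrr mul0r expr1n
    mul1r.
  apply/eqP; rewrite prodf_seq_neq0; apply/allP => c.
  rewrite mem_index_iota => hc; apply/implyP => cl; rewrite /chat_num cl /=.
  have [->|cb] := eqVneq c b.
    rewrite subrr add0r expr1n mul1r ltnNge (leq_trans _ ij) ?expr0 ?oner_eq0//.
    by case/andP: kbi.
  by rewrite subr0 expr1n mulr1 expf_neq0// -[1 + 1]/2%:R pnatr_eq0.
rewrite meval_num -mulrA; congr (_ * _).
rewrite big_map big_filter big_mkcondr /=.
rewrite (_ : \prod_(1 <= b < n.+1 | b != l) (if _ then x b else 1) =
   \prod_(1 <= b < n.+1 | b != l) x b ^+ (k <= b <= i)%N); last first.
  by apply: eq_bigr => b _; case: ifP.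
rewrite (@meval_prod_x h z _ (fun b y => y ^+ (k <= b <= i)%N)
   (fun b y => y ^+ (k <= b <= i)%N)); last by move=> b y; rewrite rmorphXn.
by rewrite -prodf_div.
Qed.
End ChatEval.

(** * Means of real functions over a period *)
Section RealMean.
Variable R : realType.
Local Notation mu := (@lebesgue_measure R).
Local Notation pi := (@pi R).
Local Notation I := `[0, 2 * pi]%classic.

Definition rmean (f : R -> R) : R := (2 * pi)^-1 * \int[mu]_(t in I) f t.

Lemma twopi_gt0 : 0 < 2 * pi.
Proof. by rewrite mulr_gt0// pi_gt0. Qed.

Lemma integrable_continuous (f : R -> R) : continuous f ->
  mu.-integrable I (EFin \o f).
Proof.
move=> cf; apply: continuous_compact_integrable; first exact: segment_compact.
exact: continuous_subspaceT.
Qed.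

Lemma rmeanD (f g : R -> R) : continuous f -> continuous g ->
  rmean (fun t => f t + g t) = rmean f + rmean g.
Proof.
by move=> cf cg; rewrite /rmean -mulrDr -RintegralD//;
  exact: integrable_continuous.
Qed.

Lemma rmeanZ a (f : R -> R) :
  continuous f -> rmean (fun t => a * f t) = a * rmean f.
Proof.
by move=> cf; rewrite /rmean RintegralZl// 1?mulrCA//;
  exact: integrable_continuous.
Qed.

Lemma rmean_cst a : rmean (fun=> a) = a.
Proof.
have muI := @lebesgue_measure_itv R `[0, 2 * pi]%R.
rewrite /rmean Rintegral_cst// [X in fine X]muI /= lte_fin twopi_gt0/=.
by rewrite oppr0 addr0 mulrCA mulVf ?mulr1// gt_eqF// twopi_gt0.
Qed.

Lemma eq_rmean f g : (forall t, 0 <= t <= 2 * pi -> f t = g t) ->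
  rmean f = rmean g.
Proof.
move=> fg; rewrite /rmean; congr (_ * _); apply: eq_Rintegral => t.
by rewrite inE /= in_itv /=; exact: fg.
Qed.

Lemma rmean_le (f : R -> R) K :
  continuous f -> (forall t, 0 <= t <= 2 * pi -> `|f t| <= K) ->
  `|rmean f| <= K.
Proof.
move=> cf fK; rewrite -[K in _ <= K]rmean_cst /rmean normrM gtr0_norm;
  last first.
  by rewrite invr_gt0 twopi_gt0.
rewrite ler_pM2l ?invr_gt0 ?twopi_gt0//.
apply: (le_trans (le_normr_Rintegral _ (integrable_continuous cf))) => //.
apply: le_Rintegral => //.
- apply: (@integrable_continuous (fun t => `|f t|)) => t.
  by apply: continuous_comp; [exact: cf|exact: norm_continuous].
- by apply: (@integrable_continuous (fun=> K)) => t; exact: cvg_cst.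
Qed.

Lemma rmean_deriv (f F : R -> R) : continuous f ->
  (forall t : R, is_derive t (1 :
    R) F (f t)) -> F (2 * pi) = F 0 -> rmean f = 0.
Proof.
move=> cf dF F0; rewrite /rmean /Rintegral (@continuous_FTC2 _ _ F).
- by rewrite F0 /= subrr mulr0.
- exact: twopi_gt0.
- exact: continuous_subspaceT.
- have cF : continuous F.
    move=> t; apply: differentiable_continuous; apply/derivable1_diffP.
    by case: (dF t).
  split=> [t _||]; first by case: (dF t).
    by apply: cvg_at_right_filter; exact: cF.
  by apply: cvg_at_left_filter; exact: cF.
- by move=> t _; rewrite derive1E; case: (dF t).
Qed.

Lemma cos_nat2pi m : cos (m%:R * (2 * pi)) = 1.
Proof.
by rewrite mulr_natl -[_ *+ m]add0r mulr_natl (periodicn (@cosD2pi R)) cos0.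
Qed.

Lemma sin_nat2pi m : sin (m%:R * (2 * pi)) = 0.
Proof.
by rewrite mulr_natl -[_ *+ m]add0r mulr_natl (periodicn (@sinD2pi R)) sin0.
Qed.

Lemma continuous_scaled (f : R -> R) (a : R) :
  continuous f -> continuous (fun t : R => f (a * t)).
Proof.
move=> cf t; apply: continuous_comp; last exact: cf.
by apply: cvgMr; exact: cvg_id.
Qed.

Lemma rmean_cos m : (0 < m)%N -> rmean (fun t => cos (m%:R * t)) = 0.
Proof.
move=> m0; have m0' : m%:R != 0 :> R by rewrite pnatr_eq0 -lt0n.
apply: (@rmean_deriv _ (fun t => m%:R^-1 * sin (m%:R * t))).
- by apply: continuous_scaled; exact: continuous_cos.
- move=> t; apply: is_derive_eq; rewrite /GRing.scale /=; field.
  exact: m0'.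
- by rewrite sin_nat2pi !mulr0 sin0 mulr0.
Qed.

Lemma rmean_sin m : (0 < m)%N -> rmean (fun t => sin (m%:R * t)) = 0.
Proof.
move=> m0; have m0' : m%:R != 0 :> R by rewrite pnatr_eq0 -lt0n.
apply: (@rmean_deriv _ (fun t => - (m%:R^-1) * cos (m%:R * t))).
- by apply: continuous_scaled; exact: continuous_sin.
- move=> t; apply: is_derive_eq; rewrite /GRing.scale /=; field.
  exact: m0'.
- by rewrite cos_nat2pi mulr0 cos0.
Qed.

End RealMean.

(** * Means of complex functions over a period *)
Section ComplexMean.
Variable R : realType.
Local Notation C := R[i].
Local Notation pi := (@pi R).
Local Notation Re := (@complex.Re R).
Local Notation Im := (@complex.Im R).
Local Notation normc := (@Normc.normc R).

(** Continuity is required of the two coordinates since circle integrals are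
    defined coordinatewise. *)
Definition ccont (g : R -> C) : Prop :=
  continuous (fun t : R => Re (g t)) /\ continuous (fun t : R => Im (g t)).

Definition cmean (g : R -> C) : C :=
  (rmean (fun t => Re (g t)) +i* rmean (fun t => Im (g t)))%C.

Lemma complex_ReM (x y : C) : Re (x * y) = Re x * Re y - Im x * Im y.
Proof. by case: x y => [a b] [c d]. Qed.

Lemma complex_ImM (x y : C) : Im (x * y) = Re x * Im y + Im x * Re y.
Proof. by case: x y => [a b] [c d]. Qed.

Lemma complex_ReV (x : C) : Re x^-1 = Re x / (Re x ^+ 2 + Im x ^+ 2).
Proof. by case: x => [a b]. Qed.

Lemma complex_ImV (x : C) : Im x^-1 = - (Im x / (Re x ^+ 2 + Im x ^+ 2)).
Proof. by case: x => [a b]. Qed.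

Lemma complex_ReD (x y : C) : Re (x + y) = Re x + Re y.
Proof. by case: x y => [a b] [c d]. Qed.

Lemma complex_ImD (x y : C) : Im (x + y) = Im x + Im y.
Proof. by case: x y => [a b] [c d]. Qed.

Lemma complex_ext (x y : C) : Re x = Re y -> Im x = Im y -> x = y.
Proof. by case: x y => [a b] [c d] /= -> ->. Qed.

Lemma ccont_eq f g : f =1 g -> ccont f -> ccont g.
Proof. by move=> /funext ->. Qed.

Lemma ccont_cst c : ccont (fun=> c).
Proof. by split=> t; exact: cvg_cst. Qed.

Lemma ccontD f g : ccont f -> ccont g -> ccont (fun t => f t + g t).
Proof.
move=> [f1 f2] [g1 g2]; split.
  under eq_fun do rewrite complex_ReD.
  by move=> t; apply: cvgD; [exact: f1|exact: g1].
under eq_fun do rewrite complex_ImD.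
by move=> t; apply: cvgD; [exact: f2|exact: g2].
Qed.

Lemma ccontM f g : ccont f -> ccont g -> ccont (fun t => f t * g t).
Proof.
move=> [f1 f2] [g1 g2]; split.
  under eq_fun do rewrite complex_ReM.
  move=> t; apply: cvgB; apply: cvgM;
    by [exact: f1|exact: f2|exact: g1|exact: g2].
under eq_fun do rewrite complex_ImM.
move=> t; apply: cvgD; apply: cvgM;
    by [exact: f1|exact: f2|exact: g1|exact: g2].
Qed.

Lemma ccontN f : ccont f -> ccont (fun t => - f t).
Proof.
move=> cf; apply: (ccont_eq _ (ccontM (ccont_cst (-1)) cf)) => t.
by rewrite mulN1r.
Qed.

Lemma ccontB f g : ccont f -> ccont g -> ccont (fun t => f t - g t).
Proof. by move=> cf cg; apply: ccontD => //; exact: ccontN. Qed.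

Lemma ccontV f : ccont f -> (forall t, f t != 0) -> ccont (fun t => (f t)^-1).
Proof.
move=> [f1 f2] f0.
have n0 t : Re (f t) ^+ 2 + Im (f t) ^+ 2 != 0.
  apply: contra (f0 t) => /eqP n0; apply/eqP/Normc.eq0_normc.
  by move: n0; case: (f t) => a b /= ->; rewrite sqrtr0.
have cn : continuous (fun t : R => (Re (f t) ^+ 2 + Im (f t) ^+ 2)^-1).
  move=> t; apply: cvgV => //.
  by apply: cvgD; apply: cvgM; by [exact: f1|exact: f2].
split.
  under eq_fun do rewrite complex_ReV.
  by move=> t; apply: cvgM; [exact: f1|exact: cn].
under eq_fun do rewrite complex_ImV.
by move=> t; apply: cvgN; apply: cvgM; [exact: f2|exact: cn].
Qed.

Lemma ccontX f m : ccont f -> ccont (fun t => f t ^+ m).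
Proof.
move=> cf; elim: m => [|m IHm]; first exact: ccont_cst.
by apply: (ccont_eq _ (ccontM cf IHm)) => t; rewrite exprS.
Qed.

Lemma ccont_sum (J : Type) (s : seq J) (P : pred J) (F : J -> R -> C) :
  (forall j, P j -> ccont (F j)) -> ccont (fun t => \sum_(j <- s | P j) F j t).
Proof.
move=> cF; elim: s => [|j s IHs].
  by apply: (ccont_eq _ (ccont_cst 0)) => t; rewrite big_nil.
have [Pj|Pj] := boolP (P j).
  by apply: (ccont_eq _ (ccontD (cF j Pj) IHs)) => t; rewrite big_cons Pj.
by apply: (ccont_eq _ IHs) => t; rewrite big_cons (negPf Pj).
Qed.

Lemma ccont_prod (J : eqType) (s : seq J) (P : pred J) (F : J -> R -> C) :
  (forall j, j \in s -> P j -> ccont (F j)) ->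
  ccont (fun t => \prod_(j <- s | P j) F j t).
Proof.
elim: s => [|j s IHs] cF.
  by apply: (ccont_eq _ (ccont_cst 1)) => t; rewrite big_nil.
have cs : ccont (fun t => \prod_(j <- s | P j) F j t).
  by apply: IHs => i si; apply: cF; rewrite inE si orbT.
have [Pj|Pj] := boolP (P j).
  apply: (ccont_eq _ (ccontM (cF j _ Pj) cs)) => [t|]; last exact: mem_head.
  by rewrite big_cons Pj.
by apply: (ccont_eq _ cs) => t; rewrite big_cons (negPf Pj).
Qed.

Lemma normc_ge0 (z : C) : 0 <= normc z.
Proof. by case: z => a b; exact: sqrtr_ge0. Qed.

Lemma normcX (z : C) m : normc (z ^+ m) = normc z ^+ m.
Proof.
by elim: m => [|m IHm]; [exact: Normc.normc1|rewrite !exprS Normc.normcM IHm].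
Qed.

Lemma normc_eq0 (z : C) : (normc z == 0) = (z == 0).
Proof.
by apply/eqP/eqP => [/Normc.eq0_normc//|->]; exact: Normc.normc0.
Qed.

Lemma Re_le_normc (z : C) : `|Re z| <= normc z.
Proof.
by case: z => a b /=; rewrite -sqrtr_sqr ler_wsqrtr// lerDl sqr_ge0.
Qed.

Lemma Im_le_normc (z : C) : `|Im z| <= normc z.
Proof.
by case: z => a b /=; rewrite -sqrtr_sqr ler_wsqrtr// lerDr sqr_ge0.
Qed.

Lemma normc_le_ReIm (z : C) : normc z <= `|Re z| + `|Im z|.
Proof.
case: z => a b /=; rewrite -[leRHS]ger0_norm ?addr_ge0// -sqrtr_sqr.
rewrite ler_wsqrtr// -[a ^+ 2]real_normK ?num_real//.
rewrite -[b ^+ 2]real_normK ?num_real// sqrrD.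
by have := mulr_ge0 (normr_ge0 a) (normr_ge0 b); lra.
Qed.

(** Only the parameters of one period are considered, because the bound comes
    from compactness. *)
Lemma normc_bounded g : ccont g ->
  exists K, forall t, 0 <= t <= 2 * pi -> normc (g t) <= K.
Proof.
move=> [g1 g2].
have [||c _ hc] := @EVT_max R (fun t => `|Re (g t)| + `|Im (g t)|) 0 (2 * pi).
- exact/ltW/twopi_gt0.
- apply: continuous_subspaceT => t; apply: cvgD.
    by apply: continuous_comp; [exact: g1|exact: norm_continuous].
  by apply: continuous_comp; [exact: g2|exact: norm_continuous].
exists (`|Re (g c)| + `|Im (g c)|) => t ht.
by apply: (le_trans (normc_le_ReIm _)); apply: hc; rewrite in_itv.
Qed.

Lemma cmeanD f g : ccont f -> ccont g ->
  cmean (fun t => f t + g t) = cmean f + cmean g.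
Proof.
move=> [f1 f2] [g1 g2]; apply: complex_ext;
  rewrite ?complex_ReD ?complex_ImD /cmean /=.
  by under eq_fun do rewrite complex_ReD; exact: rmeanD.
by under eq_fun do rewrite complex_ImD; exact: rmeanD.
Qed.

Lemma cmeanZ a f : ccont f -> cmean (fun t => a * f t) = a * cmean f.
Proof.
move=> [f1 f2].
have cZ (b : R) (u : R -> R) : continuous u -> continuous (fun t => b * u t).
  by move=> cu t; apply: cvgM; [exact: cvg_cst|exact: cu].
apply: complex_ext; rewrite ?complex_ReM ?complex_ImM /cmean /=.
  under eq_fun do rewrite complex_ReM -mulNr.
  by rewrite rmeanD; [|exact: cZ|exact: cZ]; rewrite !rmeanZ// mulNr.
under eq_fun do rewrite complex_ImM.
by rewrite rmeanD; [|exact: cZ|exact: cZ]; rewrite !rmeanZ.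
Qed.

Lemma cmean_cst a : cmean (fun=> a) = a.
Proof. by rewrite /cmean !rmean_cst; case: a. Qed.

Lemma eq_cmean f g : (forall t, 0 <= t <= 2 * pi -> f t = g t) ->
  cmean f = cmean g.
Proof. by move=> fg; apply: complex_ext; apply: eq_rmean => t ht;
  rewrite fg. Qed.

Lemma cmeanB f g : ccont f -> ccont g ->
  cmean (fun t => f t - g t) = cmean f - cmean g.
Proof.
move=> cf cg; rewrite cmeanD//; last exact: ccontN.
congr (_ + _); rewrite -mulN1r -cmeanZ//.
by apply: eq_cmean => t _; rewrite mulN1r.
Qed.

Lemma cmean_sum (J : Type) (s : seq J) (P : pred J) (F : J -> R -> C) :
  (forall j, P j -> ccont (F j)) ->
  cmean (fun t => \sum_(j <- s | P j) F j t) = \sum_(j <- s | P j) cmean (F j).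
Proof.
move=> cF; elim: s => [|j s IHs].
  rewrite big_nil -[RHS](cmean_cst 0); apply: eq_cmean => t _.
  by rewrite big_nil.
rewrite big_cons; case: ifP => Pj; last first.
  by rewrite -IHs; apply: eq_cmean => t _; rewrite big_cons Pj.
rewrite -IHs -cmeanD; [|exact: cF|exact: ccont_sum].
by apply: eq_cmean => t _; rewrite big_cons Pj.
Qed.

(** The factor 2 comes from bounding the two coordinates separately. *)
Lemma normc_cmean_le g K : ccont g ->
  (forall t, 0 <= t <= 2 * pi -> normc (g t) <= K) -> normc (cmean g) <= 2 * K.
Proof.
move=> [g1 g2] gK; apply: (le_trans (normc_le_ReIm _));
  rewrite mulr_natl mulr2n.
apply: lerD; apply: rmean_le => // t /gK; apply: le_trans.
  exact: Re_le_normc.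
exact: Im_le_normc.
Qed.

Lemma normc_geometric_eq0 (z : C) (K rho : R) : 0 <= rho < 1 ->
  (forall m : nat, normc z <= K * rho ^+ m) -> z = 0.
Proof.
move=> /andP[rho0 rho1] hz; apply: Normc.eq0_normc; apply/eqP.
rewrite eq_le normc_ge0 andbT.
have cK : (K * rho ^+ m @[m --> \oo] --> K * 0)%classic.
  by apply: cvgMr; apply: cvg_expr; rewrite ger0_norm.
rewrite mulr0 in cK; rewrite -(cvg_lim _ cK)//.
by apply: limr_ge; [exact: cvgP cK|exact: nearW].
Qed.

(** All the terms of the series but the first have mean 0.  It is used with u a
    point of a circle or its inverse, according to whether the pole lies outside
    or inside the circle. *)
Lemma cmean_series (u g : R -> C) (c : nat -> C) (K rho : R) :
  ccont u -> ccont g -> 0 <= rho < 1 ->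
  (forall m, (0 < m)%N -> cmean (fun t => u t ^+ m) = 0) ->
  (forall m t, 0 <= t <= 2 * pi ->
    normc (g t - \sum_(0 <= q < m.+1) c q * u t ^+ q) <= K * rho ^+ m) ->
  cmean g = c 0%N.
Proof.
move=> cu cg rho01 u0 hg; apply/eqP; rewrite -subr_eq0; apply/eqP.
apply: (@normc_geometric_eq0 _ (2 * K) rho rho01) => m.
have cF q : ccont (fun t => c q * u t ^+ q).
  by apply: ccontM; [exact: ccont_cst|exact: ccontX].
suff -> : c 0%N = cmean (fun t => \sum_(0 <= q < m.+1) c q * u t ^+ q).
  rewrite -cmeanB//; last exact: ccont_sum.
  rewrite -mulrA; apply: normc_cmean_le; last by move=> t; exact: hg.
  by apply: ccontB => //; exact: ccont_sum.
rewrite cmean_sum// big_nat_recl//= big1_seq ?addr0; last first.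
  by move=> q _; rewrite cmeanZ ?u0 ?mulr0//; exact: ccontX.
rewrite -[LHS]cmean_cst; apply: eq_cmean => t _.
by rewrite expr0 mulr1.
Qed.

Definition circ (r t : R) : C := ((r * cos t) +i* (r * sin t))%C.

Lemma normc_circ r t : 0 <= r -> normc (circ r t) = r.
Proof.
move=> r0; rewrite /= !exprMn -mulrDr cos2Dsin2 mulr1 sqrtr_sqr ger0_norm//.
Qed.

Lemma circ_neq0 r t : 0 < r -> circ r t != 0.
Proof. by move=> r0; rewrite -normc_eq0 normc_circ ?gt_eqF// ltW. Qed.

Lemma ccont_circ r : ccont (circ r).
Proof.
split=> t /=; apply: cvgM; try exact: cvg_cst.
  exact: continuous_cos.
exact: continuous_sin.
Qed.

Lemma circX r t m :
  circ r t ^+ m = ((r ^+ m * cos (m%:R * t)) +i* (r ^+ m * sin (m%:R * t)))%C.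
Proof.
elim: m => [|m IHm].
  by rewrite !expr0 mul0r cos0 sin0 mulr1 mulr0.
rewrite exprS IHm -[m.+1]addn1 natrD mulrDl mul1r cosD sinD.
by apply: complex_ext; rewrite ?complex_ReM ?complex_ImM /= addn1 !exprS; ring.
Qed.

Lemma cmean_circX r m : (0 < m)%N -> cmean (fun t => circ r t ^+ m) = 0.
Proof.
move=> m0; apply: complex_ext => /=; under eq_fun do rewrite circX /=.
  rewrite rmeanZ ?rmean_cos ?mulr0//.
  by apply: continuous_scaled; exact: continuous_cos.
rewrite rmeanZ ?rmean_sin ?mulr0//.
by apply: continuous_scaled; exact: continuous_sin.
Qed.

Lemma circV r t : (circ r t)^-1 = circ r^-1 (- t).
Proof.
rewrite /circ cosN sinN; apply: complex_ext;
  rewrite ?complex_ReV ?complex_ImV /= !exprMn -mulrDr.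
  rewrite cos2Dsin2 mulr1; have [->|r0] := eqVneq r 0.
    by rewrite invr0 !mul0r.
  by field.
rewrite cos2Dsin2 mulr1; have [->|r0] := eqVneq r 0.
  by rewrite invr0 !mul0r oppr0.
by field.
Qed.

Lemma cmean_circVX r m : (0 < m)%N -> cmean (fun t => (circ r t)^-1 ^+ m) = 0.
Proof.
move=> m0; apply: complex_ext => /=;
  under eq_fun do rewrite circV circX mulrN ?cosN ?sinN /=.
  rewrite rmeanZ ?rmean_cos ?mulr0//.
  by apply: continuous_scaled; exact: continuous_cos.
under eq_fun do rewrite mulrN -mulNr.
rewrite rmeanZ ?rmean_sin ?mulr0//.
by apply: continuous_scaled; exact: continuous_sin.
Qed.

End ComplexMean.

(** * Means of Cauchy kernels *)
Section CircleAverages.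
Variable R : realType.
Local Notation C := R[i].
Local Notation pi := (@pi R).
Local Notation Re := (@complex.Re R).
Local Notation Im := (@complex.Im R).
Local Notation normc := (@Normc.normc R).

Lemma geometric_remainder (F : fieldType) (a b : F) m : b != 0 -> a != b ->
  (a - b)^-1 + \sum_(0 <= q < m) b^-1 ^+ q.+1 * a ^+ q = (a / b) ^+ m / (a - b).
Proof.
move=> b0 ab; have ab0 : a - b != 0 by rewrite subr_eq0.
elim: m => [|m IHm]; first by rewrite big_geq// addr0 expr0 mul1r.
rewrite big_nat_recr//= addrA IHm !exprMn !exprS; field.
by rewrite b0 ab0 /= ?expf_neq0.
Qed.

Lemma normcB_ge (x y : C) : normc x - normc y <= normc (x - y).
Proof. by rewrite lerBlDr -[x in leLHS](subrK y); exact: le_normcD. Qed.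

Lemma normc_neq (x y : C) : normc x < normc y -> x != y.
Proof. by apply: contraTneq => ->; rewrite ltxx. Qed.

Lemma normc_remainder_le (a b : C) (r s : R) m :
  0 < s -> normc a <= r -> r < s -> normc b = s ->
  normc ((a / b) ^+ m / (a - b)) <= (s - r)^-1 * (r / s) ^+ m.
Proof.
move=> s0 ar rs bs; have ab : r < normc b by rewrite bs.
rewrite Normc.normcM normcX Normc.normcM !Normc.normcV bs mulrC.
have rs0 : 0 < s - r by rewrite subr_gt0.
apply: ler_pM; rewrite ?invr_ge0 ?exprn_ge0 ?normc_ge0//.
- by rewrite mulr_ge0 ?normc_ge0// invr_ge0 ltW.
- rewrite lef_pV2 ?posrE//; last first.
    rewrite lt_neqAle normc_ge0 andbT eq_sym normc_eq0 subr_eq0.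
    by rewrite normc_neq// bs (le_lt_trans ar).
  rewrite -normcN opprB; apply: le_trans (normcB_ge _ _).
  by rewrite bs lerD2l lerN2.
- rewrite lerXn2r ?nnegrE ?ler_pM2r ?invr_gt0// mulr_ge0 ?invr_ge0 ?normc_ge0
    ?(ltW s0)//.
  exact: le_trans (normc_ge0 a) ar.
Qed.

(** Here 1 / (z - x) is the sum of the x^q / z^(q + 1), which has no constant
    term. *)
Lemma cmean_inv_inside r (x : C) : normc x < r ->
  cmean (fun t => (circ r t - x)^-1) = 0.
Proof.
move=> xr; have r0 : 0 < r by exact: le_lt_trans (normc_ge0 x) xr.
have nc t : normc (circ r t) = r by rewrite normc_circ// ltW.
have xc t : x != circ r t by rewrite normc_neq// nc.
pose c q := if q is p.+1 then x ^+ p else 0.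
apply: (@cmean_series _ (fun t =>
  (circ r t)^-1) _ c (r - normc x)^-1 (normc x / r)).
- by apply: ccontV; [exact: ccont_circ|move=> t; exact: circ_neq0].
- apply: ccontV; first by apply: ccontB; [exact: ccont_circ|exact: ccont_cst].
  by move=> t; rewrite subr_eq0 eq_sym.
- by rewrite mulr_ge0 ?normc_ge0 ?invr_ge0 ?(ltW r0)//= ltr_pdivrMr ?mul1r.
- by move=> m m0; exact: cmean_circVX.
move=> m t _; rewrite -normcN opprB big_nat_recl//= mul0r add0r.
suff -> : \sum_(0 <= i < m) x ^+ i * (circ r t)^-1 ^+ i.+1 - (circ r t - x)^-1 =
    (x / circ r t) ^+ m / (x - circ r t).
  by rewrite normc_remainder_le.
rewrite -geometric_remainder// ?circ_neq0// -[x - _]opprB invrN addrC.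
by congr (_ + _); apply: eq_bigr => i _; rewrite mulrC.
Qed.

(** Psi(w) is, up to sign, the Cauchy integral at w of A(z) / z over the circle
    of radius s; it is considered on the smaller circle of radius r. *)
Section Swap.
Variables (r s : R) (A : R -> C).
Hypotheses (r0 : 0 < r) (rs : r < s) (cA : ccont A).
Let Psi (w : C) : C := cmean (fun t => A t * (w - circ s t)^-1).

Let s0 : 0 < s. Proof. exact: lt_trans r0 rs. Qed.

Let cker w : normc w = r -> ccont (fun t => (w - circ s t)^-1).
Proof.
move=> wr; apply: ccontV; first by apply: ccontB;
  [exact: ccont_cst|exact: ccont_circ].
by move=> t; rewrite subr_eq0 normc_neq// wr normc_circ// ltW.
Qed.

(** Psi is Lipschitz because 1 / (w - z) is, uniformly for |z| = s. *)
Lemma ccont_cauchy : ccont (fun u => Psi (circ r u)).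
Proof.
have [K AK] := normc_bounded cA.
have nr u : normc (circ r u) = r by rewrite normc_circ// ltW.
have ns u : normc (circ s u) = s by rewrite normc_circ// ltW.
have K0 : 0 <= K.
  by apply: le_trans (normc_ge0 (A 0)) (AK _ _); rewrite lexx ltW ?twopi_gt0.
pose L := 2 * (K * (s - r)^-1 ^+ 2).
have lip w w' : normc w = r -> normc w' = r ->
  normc (Psi w - Psi w') <= L * normc (w - w').
  move=> wr w'r; rewrite /Psi -cmeanB; [|by apply: ccontM => //; exact: cker..].
  rewrite /L -mulrA; apply: normc_cmean_le.
    by apply: ccontB; apply: ccontM => //; exact: cker.
  move=> t ht.
  have inv_le v : normc v = r -> normc (v - circ s t)^-1 <= (s - r)^-1.
    move=> vr; have := @normc_remainder_le v (circ s t) r s 0.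
    by rewrite !expr0 mul1r mulr1; apply; rewrite ?vr.
  have -> : A t / (w - circ s t) - A t / (w' - circ s t) =
     A t * ((w - circ s t)^-1 * (w' - circ s t)^-1) * (w' - w).
    have w0 v : normc v = r -> v - circ s t != 0.
      by move=> vr; rewrite subr_eq0 normc_neq// vr ns.
    by field; rewrite !w0.
  rewrite !Normc.normcM -[normc (w' - w)]normcN opprB expr2.
  apply: ler_wpM2r; first exact: normc_ge0.
  apply: ler_pM; rewrite ?mulr_ge0 ?normc_ge0 ?AK//.
  by apply: ler_pM; rewrite ?normc_ge0 ?inv_le.
have L0 : 0 <= L by rewrite /L mulr_ge0// mulr_ge0// exprn_ge0// invr_ge0
  subr_ge0 ltW.
have [cr1 cr2] := ccont_circ r.
have cont (F : C -> R) : (forall x y, F (x + y) = F x + F y) ->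
    (forall x, `|F x| <= normc x) -> continuous (fun u => F (Psi (circ r u))).
  move=> FD Fn u.
  have F0 : F 0 = 0 by apply: (addrI (F 0)); rewrite -FD !addr0.
  pose d v := L * (`|Re (circ r v) - Re (circ r u)| + `|Im (circ r v) - Im
    (circ r u)|).
  have d0 : (d v @[v --> u] --> 0)%classic.
    rewrite [X in (_ --> X)%classic](_ :
      0 = L * (`|Re (circ r u) - Re (circ r u)|
      + `|Im (circ r u) - Im (circ r u)|));
        last by rewrite !subrr !normr0 addr0 mulr0.
    apply: cvgMr; apply: cvgD; apply: cvg_norm; apply: cvgB; try exact: cvg_cst.
      exact: cr1.
    exact: cr2.
  apply/cvgrPdist_le => e e0.
  move/cvgr0Pnorm_le : d0 => /(_ _ e0); apply: filterS => v.
  apply: le_trans; rewrite -[X in F X](subrK (Psi (circ r v))) FD addrK.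
  apply: (le_trans (Fn _)); apply: le_trans (lip _ _ (nr _) (nr _)) _.
  rewrite [leRHS]ger0_norm; last by rewrite /d; apply: (mulr_ge0 L0);
    apply: addr_ge0.
  apply: ler_wpM2l => //; rewrite -normcN opprB.
  apply: (le_trans (normc_le_ReIm _)).
  by case: (circ r v) (circ r u) => [? ?] [? ?].
by split; apply: cont; [exact: complex_ReD|exact: Re_le_normc|exact:
  complex_ImD|exact: Im_le_normc].
Qed.

(** The mean of Psi over the circle of radius r is Psi(0), the constant term of
    its power series.  Since - 1 / z is the mean of
    1 / (w - z) over w, this is also the interchange of the mean over w with the
    mean over the larger circle. *)
Lemma cmean_cauchy :
  cmean (fun u => Psi (circ r u)) = cmean (fun t => A t * - (circ s t)^-1).
Proof.
have [K AK] := normc_bounded cA.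
have nr u : normc (circ r u) = r by rewrite normc_circ// ltW.
have ns u : normc (circ s u) = s by rewrite normc_circ// ltW.
have cV : ccont (fun t => (circ s t)^-1).
  by apply: ccontV; [exact: ccont_circ|move=> t; exact: circ_neq0].
have cAV q : ccont (fun t => A t * - (circ s t)^-1 ^+ q.+1).
  by apply: ccontM => //; apply: ccontN; exact: ccontX.
pose c q := cmean (fun t => A t * - (circ s t)^-1 ^+ q.+1).
rewrite [LHS](@cmean_series _ (circ r) _ c (2 * (K * (s - r)^-1 * (r / s))) (r
  / s)) //.
- exact: ccont_circ.
- exact: ccont_cauchy.
- by rewrite mulr_ge0 ?invr_ge0 ?(ltW r0) ?(ltW s0)//= ltr_pdivrMr ?mul1r.
- by move=> m m0; exact: cmean_circX.
move=> m u _; set w := circ r u.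
have -> : Psi w - \sum_(0 <= q < m.+1) c q * w ^+ q =
    cmean (fun t => A t * ((w / circ s t) ^+ m.+1 / (w - circ s t))).
  have cw q : ccont (fun t => w ^+ q * (A t * - (circ s t)^-1 ^+ q.+1)).
    by apply: ccontM; [exact: ccont_cst|exact: cAV].
  transitivity (cmean (fun t => A t * (w - circ s t)^-1 -
     \sum_(0 <= q < m.+1) w ^+ q * (A t * - (circ s t)^-1 ^+ q.+1))).
    rewrite cmeanB; [|by apply: ccontM => //; exact/cker/nr|exact: ccont_sum].
    rewrite cmean_sum//; congr (_ - _); apply: eq_bigr => q _.
    by rewrite (cmeanZ _ (cAV q)) [RHS]mulrC.
  apply: eq_cmean => t _.
  rewrite -geometric_remainder ?circ_neq0//; last by rewrite normc_neq// nr ns.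
  rewrite mulrDr; congr (_ + _); rewrite -sumrN mulr_sumr.
  by apply: eq_bigr => q _; ring.
rewrite (_ : _ * _ ^+ m = 2 * (K * ((s - r)^-1 * (r / s) ^+ m.+1))); last first.
  by rewrite exprS !mulrA.
apply: normc_cmean_le.
  apply: ccontM => //; apply: ccontM; last exact/cker/nr.
  by apply: ccontX; apply: ccontM => //; exact: ccont_cst.
move=> t ht; rewrite Normc.normcM; apply: ler_pM; rewrite ?normc_ge0 ?AK//.
by rewrite normc_remainder_le ?nr ?ns.
Qed.

End Swap.

End CircleAverages.

(** * Iterated integrals over the torus *)
Section Torus.
Variable R : realType.
Local Notation C := R[i].
Local Notation Re := (@complex.Re R).
Local Notation Im := (@complex.Im R).
Local Notation normc := (@Normc.normc R).

Definition twopii : C := 2 * (pi : R)%:C%C * 'i%C.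

Lemma twopii_neq0 : twopii != 0.
Proof.
rewrite /twopii !mulf_neq0 ?pnatr_eq0//.
  by rewrite (fmorph_eq0 (real_complex R)) gt_eqF// pi_gt0.
by rewrite eq_complex /= oner_eq0 andbF.
Qed.

(** On the circle dz = i z dt, so that integrating f(z) dz amounts to averaging
    z f(z). *)
Lemma circle_integralE r (f : C -> C) (H : R -> C) :
  (forall t, f (circ r t) * circ r t = H t) -> ccont H ->
  circle_integral r f = twopii * cmean H.
Proof.
move=> fH [H1 H2].
have E (t : R) : f (circ r t) * ('i%C * circ r t) =
  'i%C * H t by rewrite mulrCA fH.
have rmeanE (u : R -> R) : (\int[lebesgue_measure]_(t in `[0%R, (2 *
  pi)%R]%classic) u t)%R =
    2 * pi * rmean u.
  by rewrite /rmean mulVKf// gt_eqF// twopi_gt0.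
rewrite /circle_integral; apply: complex_ext.
  rewrite [RHS]complex_ReM [LHS]/= rmeanE /cmean /twopii !complex_ReM
    !complex_ImM /=.
  transitivity (2 * pi * rmean (fun t => (-1) * Im (H t))).
    congr (_ * _); apply: eq_rmean => t _;
      rewrite -/(circ r t) E complex_ReM /=; ring.
  by rewrite rmeanZ//; ring.
rewrite [RHS]complex_ImM [LHS]/= rmeanE /cmean /twopii !complex_ReM
  !complex_ImM /=.
transitivity (2 * pi * rmean (fun t => Re (H t))).
  congr (_ * _); apply: eq_rmean => t _;
    rewrite -/(circ r t) E complex_ImM /=; ring.
by ring.
Qed.

Definition torus_radius (b : nat) : R := (b.+1)%:R^-1.
Local Notation pt b t := (circ (torus_radius b) t).

Lemma torus_radius_gt0 b : 0 < torus_radius b.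
Proof. by rewrite invr_gt0 ltr0n. Qed.

Lemma torus_radius_lt b c : (b < c)%N -> torus_radius c < torus_radius b.
Proof. by move=> bc; rewrite ltf_pV2 ?posrE ?ltr0n// ltr_nat ltnS. Qed.

Lemma normc_pt b t : normc (pt b t) = torus_radius b.
Proof. by rewrite normc_circ// ltW// torus_radius_gt0. Qed.

Lemma pt_neq0 b t : pt b t != 0.
Proof. by rewrite circ_neq0// torus_radius_gt0. Qed.

Lemma pt_neq b c t u : b != c -> pt b t != pt c u.
Proof.
rewrite neq_ltn => /orP[] bc;
  last by rewrite normc_neq// !normc_pt torus_radius_lt.
by rewrite eq_sym normc_neq// !normc_pt torus_radius_lt.
Qed.

Definition set_coord (z : nat -> C) (m : nat) (w : C) : nat -> C :=
  fun b => if b == m then w else z b.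

(** Only the restriction of F to the points with the given outer coordinates
    matters; this is what lets the induction treat the factor of the last variable
    as a constant. *)
Lemma torus_integral_prod m (G : nat -> C -> C) (F : (nat -> C) -> C) z c :
  (forall b, (1 <= b <= m)%N -> ccont (fun t => G b (pt b t))) ->
  (forall z', (forall b, (m < b)%N -> z' b = z b) ->
     F z' = c * \prod_(1 <= b < m.+1) (G b (z' b) / z' b)) ->
  torus_integral m F z =
    c * \prod_(1 <= b < m.+1) (twopii * cmean (fun t => G b (pt b t))).
Proof.
elim: m z c => [|m IHm] z c cG hF.
  by rewrite /= (hF z)// !big_geq.
have cGm : ccont (fun t => G m.+1 (pt m.+1 t)) by apply: cG; rewrite leqnn.
pose Pm := \prod_(1 <= b < m.+1) (twopii * cmean (fun t => G b (pt b t))).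
have inner w : torus_integral m F (set_coord z m.+1 w) =
  c * (G m.+1 w / w) * Pm.
  apply: IHm => [b /andP[b1 bm]|z' hz']; first by apply: cG; rewrite b1 leqW.
  rewrite hF; last first.
    by move=> b mb; rewrite hz' ?(ltnW mb)// /set_coord gtn_eqF.
  by rewrite big_nat_recr//= hz'// /set_coord eqxx mulrA mulrAC.
rewrite big_nat_recr//= (@circle_integralE _ _ (fun t =>
  c * Pm * G m.+1 (pt m.+1 t))).
- by rewrite cmeanZ// -/Pm; ring.
- by move=> t; rewrite -/(set_coord z m.+1 _) inner; field; exact: pt_neq0.
- by apply: ccontM => //; exact: ccont_cst.
Qed.

(** The factors G b depend on the variable z_b and on a central variable z_l.  The
    variables with b < l are integrated while z_l is fixed, and the result g b
    remains in the integral over z_l.  For l < b the integral over z_l is the inner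
    one, and outer_cmean is the interchange that brings g b there too. *)
Section CentralVariable.
Variables (l : nat) (G : nat -> C -> C -> C) (g : nat -> C -> C).
Hypothesis l0 : (0 < l)%N.
Hypothesis g_cont : forall b, b != l -> ccont (fun t => g b (pt l t)).
Hypothesis inner_cont : forall b t, (b < l)%N ->
  ccont (fun u => G b (pt b u) (pt l t)).
Hypothesis inner_cmean : forall b t, (b < l)%N ->
  cmean (fun u => G b (pt b u) (pt l t)) = g b (pt l t).
Hypothesis outer_cont : forall b u, (l < b)%N ->
  ccont (fun t => G b (pt b u) (pt l t)).
Hypothesis outer_cmean : forall b A, (l < b)%N -> ccont A ->
  let Phi u := cmean (fun t => A t * G b (pt b u) (pt l t)) in
  ccont Phi /\ cmean Phi = cmean (fun t => A t * g b (pt l t)).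

(** The function a is arbitrary so that the induction on the number of variables
    can absorb into it the factor of the outermost one. *)
Lemma torus_integral_central m (F : (nat -> C) -> C) z (a : C -> C) :
  (l <= m)%N -> ccont (fun t => a (pt l t)) ->
  (forall z', (forall b, (m < b)%N -> z' b = z b) ->
     F z' = a (z' l) / z' l *
       \prod_(1 <= b < m.+1 | b != l) (G b (z' b) (z' l) / z' b)) ->
  torus_integral m F z = twopii ^+ m *
    cmean (fun t => a (pt l t) * \prod_(1 <= b < m.+1 | b != l) g b (pt l t)).
Proof.
have cprod m' : ccont (fun t => \prod_(1 <= b < m'.+1 | b != l) g b (pt l t)).
  by apply: ccont_prod => b _; exact: g_cont.
elim: m z a => [|m IHm] z a; first by rewrite leqn0 (gtn_eqF l0).
rewrite leq_eqVlt ltnS => /orP[/eqP lE|lm] ca hF.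
  have ltl b : (1 <= b < m.+1)%N -> (b < l)%N by rewrite lE => /andP[].
  have dropl (H : nat -> C) :
    \prod_(1 <= b < m.+2 | b != l) H b = \prod_(1 <= b < m.+1) H b.
    rewrite big_mkcond big_nat_recr//= lE eqxx mulr1.
    by apply: eq_big_nat => b /ltl bl; rewrite -lE ltn_eqF.
  have inner t : torus_integral m F (set_coord z m.+1 (pt l t)) =
    a (pt l t) / pt l t *
      \prod_(1 <= b < m.+1) (twopii * cmean (fun u => G b (pt b u) (pt l t))).
    apply: (@torus_integral_prod m (fun b w => G b w (pt l t))) =>
      [b /ltl|z' hz'].
      exact: inner_cont.
    have zl : z' l = pt l t by rewrite hz' ?lE// /set_coord eqxx.
    rewrite hF ?dropl ?zl// => b mb.
    by rewrite hz' ?(ltnW mb)// /set_coord gtn_eqF.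
  rewrite /= (@circle_integralE _ _ (fun t => a (pt l t) *
      (twopii ^+ m * \prod_(1 <= b < m.+2 | b != l) g b (pt l t)))).
  - rewrite exprS -mulrA -[in RHS]cmeanZ; last exact: ccontM.
    by congr (_ * _); apply: eq_cmean => t _; ring.
  - move=> t; rewrite -/(set_coord z m.+1 _) -/(torus_radius m.+1).
    have -> : pt m.+1 t = pt l t by rewrite lE.
    rewrite inner dropl.
    rewrite big_split /= prodr_const_nat subn1 /=.
    rewrite (eq_big_nat _ _ (F2 := fun b => g b (pt l t))); last first.
      by move=> b /ltl; exact: inner_cmean.
    by field; exact: pt_neq0.
  - by apply: ccontM => //; apply: ccontM; [exact: ccont_cst|exact: cprod].
have ml : m.+1 != l by rewrite gtn_eqF.
have cap : ccont (fun t => a (pt l t) * \prod_(1 <= b < m.+1 | b != l) g b (pt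
  l t)).
  exact: ccontM.
have lm1 : (l < m.+1)%N by [].
have [cPhi cmeanPhi] := outer_cmean lm1 cap.
have inner u : torus_integral m F (set_coord z m.+1 (pt m.+1 u)) = twopii ^+ m *
    cmean (fun t => a (pt l t) * (G m.+1 (pt m.+1 u) (pt l t) / pt m.+1 u) *
      \prod_(1 <= b < m.+1 | b != l) g b (pt l t)).
  apply: (IHm _ (fun x => a x * (G m.+1 (pt m.+1 u) x / pt m.+1 u))) => //.
    by apply: ccontM => //; apply: ccontM; [exact: outer_cont|exact: ccont_cst].
  move=> z' hz'; have zm : z' m.+1 = pt m.+1 u by rewrite hz'// /set_coord eqxx.
  rewrite hF => [|b mb]; last by rewrite hz' ?(ltnW mb)// /set_coord gtn_eqF.
  rewrite [in LHS]big_mkcond big_nat_recr//= ml -big_mkcond zm /=.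
  by set P := \prod_(1 <= b < _ | _) _; ring.
rewrite /= (@circle_integralE _ _ (fun u => twopii ^+ m *
    cmean (fun t => a (pt l t) * (\prod_(1 <= b < m.+1 | b != l) g b (pt l t)) *
       G m.+1 (pt m.+1 u) (pt l t)))).
- rewrite cmeanZ// cmeanPhi mulrA -exprS; congr (_ * _); apply: eq_cmean => t _.
  rewrite [in RHS]big_mkcond big_nat_recr//= ml -big_mkcond /=.
  by set P := \prod_(1 <= b < _ | _) _; ring.
- move=> u; rewrite -/(set_coord z m.+1 _) -/(torus_radius m.+1) inner.
  rewrite -mulrA; congr (_ * _); rewrite mulrC -cmeanZ; last first.
    apply: ccontM => //; apply: ccontM => //.
    by apply: ccontM; [exact: outer_cont|exact: ccont_cst].
  apply: eq_cmean => t _; set P := \prod_(1 <= b < _ | _) _.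
  by field; exact: pt_neq0.
- by apply: ccontM => //; exact: ccont_cst.
Qed.
End CentralVariable.
End Torus.

(** * Factors with a simple pole *)
Section SimplePole.
Variable R : realType.
Local Notation C := R[i].
Local Notation pt b t := (circ (torus_radius R b) t).
Variables (l : nat) (al be ga : nat -> C) (fac : nat -> C -> C).
Hypothesis l0 : (0 < l)%N.
Hypothesis facE : forall b y, y != 0 -> fac b y = al b * y + be b + ga b / y.

(** The pole z_b = x contributes to the mean only if x is outside the circle of
    z_b. *)
Definition laurent_mean b (x : C) : C :=
  al b * - x + be b + (if (l < b)%N then ga b * - x^-1 else 0).

Let cpt b : ccont (fun t => pt b t). Proof. exact: ccont_circ. Qed.

Let cptV b : ccont (fun t => (pt b t)^-1).
Proof. by apply: ccontV => // t; exact: pt_neq0. Qed.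

Let cinvx b c t : b != c -> ccont (fun u => (pt b u - pt c t)^-1).
Proof.
move=> bc; apply: ccontV; first by apply: ccontB => //; exact: ccont_cst.
by move=> u; rewrite subr_eq0 pt_neq.
Qed.

Let cinvw b c u : b != c -> ccont (fun t => (pt b u - pt c t)^-1).
Proof.
move=> bc; apply: ccontV; first by apply: ccontB => //; exact: ccont_cst.
by move=> t; rewrite subr_eq0 pt_neq.
Qed.

Let GE b t u : b != l -> fac b (pt b u - pt l t) =
  al b * pt b u + (be b + al b * - pt l t) + ga b * (pt b u - pt l t)^-1.
Proof. by move=> bl; rewrite facE ?subr_eq0 ?pt_neq//; ring. Qed.

Lemma laurent_mean_cont b : ccont (fun t => laurent_mean b (pt l t)).
Proof.
apply: ccontD; first apply: ccontD; try exact: ccont_cst.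
  by apply: ccontM; [exact: ccont_cst|exact: ccontN].
case: (l < b)%N; last exact: ccont_cst.
by apply: ccontM; [exact: ccont_cst|exact: ccontN].
Qed.

Lemma fac_cont_in b t : (b < l)%N -> ccont (fun u => fac b (pt b u - pt l t)).
Proof.
move=> /ltn_eqF/negbT bl; apply: (ccont_eq (fun u => esym (GE t u bl))).
apply: ccontD; first apply: ccontD; try exact: ccont_cst.
  by apply: ccontM; [exact: ccont_cst|].
by apply: ccontM; [exact: ccont_cst|exact: cinvx].
Qed.

Lemma fac_cmean_in b t : (b < l)%N ->
  cmean (fun u => fac b (pt b u - pt l t)) = laurent_mean b (pt l t).
Proof.
move=> ltbl; have bl : b != l by rewrite ltn_eqF.
rewrite (eq_cmean (g := fun u => al b * pt b u + (be b + al b * - pt l t) +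
  ga b * (pt b u - pt l t)^-1)); last by move=> u _; exact: GE.
have c1 : ccont (fun u => al b * pt b u) by apply: ccontM; [exact: ccont_cst|].
rewrite cmeanD; last 2 first.
- by apply: ccontD => //; exact: ccont_cst.
- by apply: ccontM; [exact: ccont_cst|exact: cinvx].
rewrite cmeanD//; last exact: ccont_cst.
rewrite cmeanZ// (cmean_circX _ (m := 1))// cmean_cst cmeanZ; last exact: cinvx.
rewrite cmean_inv_inside ?normc_pt ?torus_radius_lt// /laurent_mean ltnNge
  (ltnW ltbl) /=.
by ring.
Qed.

Lemma fac_cont_out b u : (l < b)%N -> ccont (fun t => fac b (pt b u - pt l t)).
Proof.
move=> /gtn_eqF/negbT bl; apply: (ccont_eq (fun t => esym (GE t u bl))).
apply: ccontD; first apply: ccontD; try exact: ccont_cst.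
  apply: ccontD; first exact: ccont_cst.
  by apply: ccontM; [exact: ccont_cst|exact: ccontN].
by apply: ccontM; [exact: ccont_cst|exact: cinvw].
Qed.

Lemma fac_cmean_out b A : (l < b)%N -> ccont A ->
  let Phi u := cmean (fun t => A t * fac b (pt b u - pt l t)) in
  ccont Phi /\ cmean Phi = cmean (fun t => A t * laurent_mean b (pt l t)).
Proof.
move=> ltlb cA Phi; have bl : b != l by rewrite gtn_eqF.
have rbl : torus_radius R b < torus_radius R l by rewrite torus_radius_lt.
pose Psi u := cmean (fun t => A t * (pt b u - pt l t)^-1).
have cPsi : ccont Psi by exact: ccont_cauchy (torus_radius_gt0 R b) rbl cA.
pose B := be b * cmean A - al b * cmean (fun t => A t * pt l t).
have cAx : ccont (fun t => A t * pt l t) by exact: ccontM.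
have PhiE u : (al b * cmean A) * pt b u + B + ga b * Psi u = Phi u.
  have cAi : ccont (fun t => A t * (pt b u - pt l t)^-1).
    by apply: ccontM => //; exact: cinvw.
  have cZ c f : ccont f -> ccont (fun t : R => (c : C) * f t).
    by move=> cf; apply: ccontM => //; exact: ccont_cst.
  transitivity (cmean (fun t => (al b * pt b u + be b) * A t +
     (- al b) * (A t * pt l t) + ga b * (A t * (pt b u - pt l t)^-1))).
    rewrite cmeanD; [|by apply: ccontD; exact: cZ|exact: cZ].
    rewrite cmeanD; [|exact: cZ|exact: cZ].
    by rewrite !cmeanZ// /B /Psi; ring.
  by apply: eq_cmean => t _; rewrite GE//; ring.
have c1 : ccont (fun u => (al b * cmean A) * pt b u).
  by apply: ccontM => //; exact: ccont_cst.
have c3 : ccont (fun u => ga b * Psi u) by apply: ccontM => //;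
  exact: ccont_cst.
have c12 : ccont (fun u => (al b * cmean A) * pt b u + B).
  by apply: ccontD => //; exact: ccont_cst.
split; first exact: (ccont_eq PhiE (ccontD c12 c3)).
rewrite -(eq_cmean (f := fun u =>
  (al b * cmean A) * pt b u + B + ga b * Psi u)); last first.
  by move=> u _; exact: PhiE.
rewrite cmeanD// cmeanD//; last exact: ccont_cst.
rewrite (cmeanZ _ (cpt b)) (cmean_circX _ (m := 1))// cmean_cst (cmeanZ _ cPsi).
rewrite (cmean_cauchy (torus_radius_gt0 R b) rbl cA) /laurent_mean ltlb /B.
have cZ c f : ccont f -> ccont (fun t : R => (c : C) * f t).
  by move=> cf; apply: ccontM => //; exact: ccont_cst.
have cAV : ccont (fun t => A t * - (pt l t)^-1).
  by apply: ccontM => //; exact: ccontN.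
transitivity (cmean (fun t => be b * A t + (- al b) * (A t * pt l t) +
   ga b * (A t * - (pt l t)^-1))).
  rewrite cmeanD; [|by apply: ccontD; exact: cZ|exact: cZ].
  rewrite cmeanD; [|exact: cZ|exact: cZ].
  by rewrite !cmeanZ//; ring.
by apply: eq_cmean => t _; ring.
Qed.

Lemma torus_integral_laurent n (F : (nat -> C) -> C) z a : (l <= n)%N ->
  (forall z, F z = a * \prod_(1 <= b < n.+1 | b != l) fac b (z b - z l)) ->
  twopii R ^- n * torus_integral n (fun z =>
    F z / \prod_(1 <= b < n.+1) z b) z =
  a * cmean (fun t => \prod_(1 <= b < n.+1 | b != l) laurent_mean b (pt l t)).
Proof.
move=> ln hF.
rewrite (@torus_integral_central R l (fun b w x =>
  fac b (w - x)) laurent_mean l0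
  _ _ _ _ _ n _ z (fun=> a)) //.
- rewrite mulrA mulVf ?expf_neq0 ?twopii_neq0// mul1r cmeanZ//.
  by apply: ccont_prod => b _ _; exact: laurent_mean_cont.
- by move=> b _; exact: laurent_mean_cont.
- by move=> b t; exact: fac_cont_in.
- by move=> b t; exact: fac_cmean_in.
- by move=> b u; exact: fac_cont_out.
- by move=> b A; exact: fac_cmean_out.
- exact: ccont_cst.
- move=> z' _; rewrite hF prodf_div.
  rewrite (bigD1_seq l) ?iota_uniq ?mem_index_iota ?l0//= invfM.
  by ring.
Qed.

End SimplePole.

(** * Residues and coefficients *)
Section Residue.
Variable R : realType.
Local Notation C := R[i].

Lemma cvg_series_finite (u : nat -> C^o) N :
  (forall m, (N <= m)%N -> u m = 0) ->
  (series u @ \oo --> (\sum_(0 <= m < N) u m : C^o))%classic.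
Proof.
move=> u0; apply: cvg_near_cst; exists N => // m /= Nm.
rewrite /series /= (big_cat_nat (n := N))//= [X in _ + X]big1_seq ?addr0// => q.
by rewrite mem_index_iota => /andP[_ /andP[Nq _]]; rewrite u0.
Qed.

(** The Laurent expansion at 0 has finitely many terms, namely the coefficients of
    Q shifted by d + 1. *)
Lemma is_residue_poly (Q : {poly C}) d (f : C -> C) :
  (forall z, z != 0 -> f z = Q.[z] / z ^+ d.+1) -> is_residue f 0 Q`_d.
Proof.
move=> fE.
pose a (m : int) : C := match m with
  | Posz p => Q`_(p + d.+1)
  | Negz p => if (p <= d)%N then Q`_(d - p) else 0
  end.
exists a, 1; split=> [//|z /andP[z0 _]|]; last first.
  by have -> : a (-1) = Q`_(d - 0) by []; rewrite subn0.
rewrite subr0 in z0 *; have {}z0 : z != 0 by rewrite normr_gt0 in z0.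
exists (\sum_(0 <= m < size Q) Q`_(m + d.+1) * z ^+ m).
exists (\sum_(0 <= m < d.+1) Q`_(d - m) * z ^- m.+1); split.
- apply: cvg_series_finite => m Qm.
  by rewrite /a nth_default ?mul0r// (leq_trans Qm)// leq_addr.
- have -> : \sum_(0 <= m < d.+1) Q`_(d - m) * z ^- m.+1 =
      \sum_(0 <= m < d.+1) a (- m.+1%:Z) * z ^- m.+1.
    by apply: eq_big_nat => m /andP[_ md]; rewrite -NegzE /a -ltnS md.
  apply: cvg_series_finite => m dm.
  by rewrite -NegzE /a leqNgt dm mul0r.
rewrite fE// (@horner_coef_wide _ (d.+1 + size Q)) ?leq_addl//.
rewrite -(big_mkord xpredT (fun q =>
  Q`_q * z ^+ q)) (big_cat_nat (n := d.+1)) ?leq_addr//=.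
rewrite mulrDl addrC; congr (_ + _).
  rewrite -{1}[d.+1]add0n big_addn addKn mulr_suml; apply: eq_bigr => m _.
  by rewrite exprD mulrA mulfK// expf_neq0.
rewrite big_nat_rev mulr_suml; apply: eq_big_nat => m /andP[_ md].
rewrite add0n subSS -mulrA; congr (_ * _).
have -> : d.+1 = (m.+1 + (d - m))%N by rewrite addSn subnKC.
by rewrite exprD invfM mulrCA mulfV ?mulr1// expf_neq0.
Qed.

(** The same coefficient as in [is_residue_poly]. The sign is that of
    y = - z_l. *)
Lemma cmean_poly (Q : {poly C}) d r : 0 < r ->
  cmean (fun t => Q.[- circ r t] / (- circ r t) ^+ d) = Q`_d.
Proof.
move=> r0; have y0 t : - circ r t != 0 by rewrite oppr_eq0 circ_neq0.
have cy : ccont (fun t => - circ r t) by apply: ccontN; exact: ccont_circ.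
have cyV m : ccont (fun t => (- circ r t)^-1 ^+ m) by apply: ccontX;
  exact: ccontV.
have cc q : ccont (fun t => (- circ r t) ^+ q * (- circ r t)^-1 ^+ d).
  by apply: ccontM => //; exact: ccontX.
have cmean_mono q : cmean (fun t =>
  (- circ r t) ^+ q * (- circ r t)^-1 ^+ d) = (q == d)%:R.
  have [->|] := eqVneq q d.
    rewrite -[RHS]cmean_cst; apply: eq_cmean => t _.
    by rewrite exprVn mulfV// expf_neq0.
  rewrite neq_ltn => /orP[qd|dq].
    rewrite (eq_cmean (g := fun t =>
      (- 1) ^+ (d - q) * (circ r t)^-1 ^+ (d - q))).
      rewrite cmeanZ ?cmean_circVX ?subn_gt0 ?mulr0//; apply: ccontX;
        apply: ccontV.
        exact: ccont_circ.
      by move=> t; exact: circ_neq0.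
    move=> t _; rewrite -exprMn mulN1r -invrN -{1}(subnKC (ltnW qd)) exprD
      mulrA.
    by rewrite -exprMn mulfV// expr1n mul1r.
  rewrite (eq_cmean (g := fun t => (- 1) ^+ (q - d) * circ r t ^+ (q - d))).
    by rewrite cmeanZ ?cmean_circX ?subn_gt0 ?mulr0//; apply: ccontX;
      exact: ccont_circ.
  move=> t _; rewrite -exprMn mulN1r -{1}(subnKC (ltnW dq)) exprD mulrAC.
  by rewrite -exprMn mulfV// expr1n mul1r.
transitivity (cmean (fun t => \sum_(0 <= q < size Q)
    Q`_q * ((- circ r t) ^+ q * (- circ r t)^-1 ^+ d))).
  apply: eq_cmean => t _; rewrite horner_coef mulr_suml big_mkord.
  by apply: eq_bigr => q _; rewrite mulrA exprVn.
rewrite cmean_sum => [|q _]; last by apply: ccontM => //; exact: ccont_cst.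
under eq_bigr do rewrite cmeanZ// cmean_mono.
have [dQ|Qd] := ltnP d (size Q); last first.
  rewrite nth_default// big1_seq// => q /=;
    rewrite mem_index_iota => /andP[_ qQ].
  by rewrite ltn_eqF ?mulr0// (leq_trans qQ).
rewrite (bigD1_seq d) ?iota_uniq ?mem_index_iota//= eqxx mulr1 big1 ?addr0//.
by move=> q /negPf ->; rewrite mulr0.
Qed.

End Residue.

(** * The closed form *)

(** Replaces by its value every condition in an exponent or a conditional that
    linear arithmetic decides from the context. *)
Ltac decide_indicators :=
  repeat match goal with
  | |- context [nat_of_bool ?c] =>
      first [have -> : c = true by lia | have -> : c = false by lia]
  | |- context [if ?c then _ else _] =>
      first [have -> : c = true by lia | have -> : c = false by lia]
  end; rewrite /= ?addn0 ?add0n ?expr0 ?expr1 ?expr1n.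

Section ClosedForm.
Variable R : realType.
Local Notation C := R[i].
Local Notation pt b t := (circ (torus_radius R b) t).

Lemma sum_interval n u v : (1 <= u)%N ->
  (\sum_(1 <= b < n.+1) (u <= b < v)%N = minn v n.+1 - u)%N.
Proof.
move=> u1; elim: n => [|n IHn]; first by rewrite big_geq//; lia.
by rewrite big_nat_recr//= IHn; lia.
Qed.

Lemma prod_interval (V : comNzRingType) (w : V) n u v :
  (1 <= u)%N -> (v <= n.+1)%N ->
  \prod_(1 <= b < n.+1) w ^+ (u <= b < v)%N = w ^+ (v - u).
Proof. by move=> u1 vn; rewrite prodrXr sum_interval// (minn_idPl vn). Qed.

Variables (n i j k l : nat) (h : C).
Hypotheses (k1 : (1 <= k)%N) (jn : (j <= n)%N).
Hypotheses (kl : (k <= l)%N) (li : (l <= i)%N) (ij : (i <= j)%N).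

(** The exponents are chosen so that one formula covers all b, including the
    degenerate positions of k, l, i and j.  In particular b = i > l gives
    1 / y when i = j and (y + h) / y when i < j, and b = j > i gives 1, whence the
    interval from max(i, l + 1) to j. *)
Definition chat_factor_mean (b : nat) (y : C) : C :=
  (y + h) ^+ (1 <= b < k)%N * ((y + h) ^+ (l.+1 <= b < i)%N) ^+ 2 *
  (y + h) ^+ (maxn i l.+1 <= b < j)%N * (y + 2 * h) ^+ (k.+1 <= b < l)%N *
  y ^+ (j.+1 <= b < n.+1)%N / y ^+ (l.+1 <= b < i.+1)%N.

Lemma prod_chat_factor_mean y :
  \prod_(1 <= b < n.+1 | b != l) chat_factor_mean b y =
  (y + h) ^+ (k.-1 + 2 * (i - l.+1) + (j - maxn i l.+1)) *
  (y + 2 * h) ^+ (l - k.+1) * y ^+ (n - j) / y ^+ (i - l).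
Proof.
have l1 : (1 <= l <= n)%N by rewrite (leq_trans k1)// (leq_trans li)//
  (leq_trans ij).
have -> : \prod_(1 <= b < n.+1 | b != l) chat_factor_mean b y =
    \prod_(1 <= b < n.+1) chat_factor_mean b y.
  rewrite [RHS](bigD1_seq l) ?iota_uniq ?mem_index_iota//=.
  rewrite (_ : chat_factor_mean l y = 1) ?mul1r// /chat_factor_mean.
  by decide_indicators; rewrite !mul1r invr1.
rewrite prodf_div !big_split /= !prod_interval//; try lia.
rewrite mul2n -addnn !exprD !subn1 !subSS /=; ring.
Qed.

(** The factor chat_factor b is 1, x or x + h for b outside [k, i], and for b in
    [k, i] it is (x + h)^p / x with p <= 2; each of these six shapes has its own
    triple of coefficients. The conditional in the second equation is the mean of
    ga / (z_b - z_l). *)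
Lemma chat_factor_laurent b : exists abc : C * C * C,
  (forall y, y != 0 -> chat_factor i j k h b y =
    abc.1.1 * y + abc.1.2 + abc.2 / y) /\
  ((1 <= b <= n)%N -> b != l -> forall y, y != 0 ->
     chat_factor_mean b y = abc.1.1 * y + abc.1.2 + (if (l < b)%N then abc.2 /
       y else 0)).
Proof.
have [kbi|kbi] := boolP (k <= b <= i)%N; last first.
  have [bk|bk] := boolP ((b < k) || (i < b < j))%N.
    exists (1, h, 0); rewrite /chat_factor /chat_num /chat_factor_mean.
    split=> [y y0|bn bl y y0]; first by decide_indicators; field.
    move/orP: bk => [bk|bk].
      by decide_indicators; field.
    by decide_indicators; field.
  have [bj|bj] := eqVneq b j.
    exists (0, 1, 0); rewrite /chat_factor /chat_num /chat_factor_mean.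
    by split=> [y y0|bn bl y y0]; decide_indicators; field.
  exists (1, 0, 0); rewrite /chat_factor /chat_num /chat_factor_mean.
  by split=> [y y0|bn bl y y0]; decide_indicators; field.
have [kbi'|kbi'] := boolP (k < b < i)%N.
  exists (1, 2 * h, h ^+ 2); rewrite /chat_factor /chat_num /chat_factor_mean.
  split=> [y y0|bn bl y y0]; first by decide_indicators; field.
  have [lb|lb] := ltnP l b; first by decide_indicators; field.
  by decide_indicators; field.
have [bj|bj] := ltnP b j.
  exists (0, 1, h); rewrite /chat_factor /chat_num /chat_factor_mean.
  split=> [y y0|bn bl y y0]; first by decide_indicators; field.
  have [lb|lb] := ltnP l b; first by decide_indicators; field.
  by decide_indicators; field.
exists (0, 0, 1); rewrite /chat_factor /chat_num /chat_factor_mean.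
by split=> [y y0|bn bl y y0]; decide_indicators; field.
Qed.

Let e := ((l < i)%N + (l < j)%N + (k < l)%N)%N.

Definition ccoef_poly : {poly C} :=
  h ^+ e *: (('X + h%:P) ^+ (k.-1 + 2 * (i - l.+1) + (j - maxn i l.+1)) *
    ('X + (2 * h)%:P) ^+ (l - k.+1) * 'X^(n - j)).

Lemma horner_ccoef_poly (z : C) :
  ccoef_poly.[z] = h ^+ e *
    ((z + h) ^+ (k.-1 + 2 * (i - l.+1) + (j - maxn i l.+1)) *
    (z + 2 * h) ^+ (l - k.+1) * z ^+ (n - j)).
Proof.
by rewrite /ccoef_poly hornerZ !hornerM !horner_exp !hornerD hornerX !hornerC.
Qed.

Lemma ccoefE : ccoef n i j k l h = ccoef_poly`_(i - l).
Proof.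
have hl : (1 <= l <= n)%N by rewrite (leq_trans k1)// (leq_trans li)//
  (leq_trans ij).
have [l1 ln] := andP hl.
have [abc habc] := choice chat_factor_laurent.
have torusE := @torus_integral_laurent R l (fun b => (abc b).1.1) (fun b =>
  (abc b).1.2)
  (fun b => (abc b).2) (chat_factor i j k h) l1 (fun b => (habc b).1) n
  (fun z => fraction_eval (chat R n i j k l) (hzpoint h z)) (fun=> 0) (h ^+ e)
    ln
  (fun z => fraction_eval_chat hl kl li ij h z).
rewrite -exprVn in torusE; rewrite [LHS]torusE.
rewrite -(@cmean_poly _ _ _ (torus_radius R l)); last exact: torus_radius_gt0.
rewrite -cmeanZ; last by apply: ccont_prod => b _ _; exact: laurent_mean_cont.
apply: eq_cmean => t _; have y0 : - pt l t != 0 by rewrite oppr_eq0 pt_neq0.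
rewrite [\prod_(_ <= _ < _ | _) _](_ : _ =
    \prod_(1 <= b < n.+1 | b != l) chat_factor_mean b (- pt l t)); last first.
  rewrite [LHS]big_nat_cond [RHS]big_nat_cond; apply: eq_bigr => b /andP[hb bl].
  rewrite (proj2 (habc b) hb bl _ y0) /laurent_mean; congr (_ + _).
  by case: ifP => // _; rewrite invrN.
by rewrite prod_chat_factor_mean horner_ccoef_poly !mulrA.
Qed.

End ClosedForm.

Lemma circle_integral0 (R : realType) r : circle_integral r (fun=> 0 :
  R[i]) = 0.
Proof.
rewrite (@circle_integralE _ _ _ (fun=> 0)) ?cmean_cst ?mulr0//.
  by move=> t; rewrite mul0r.
exact: ccont_cst.
Qed.

Lemma torus_integral0 (R : realType) m (F : (nat -> R[i]) -> R[i]) z :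
  (forall z, F z = 0) -> torus_integral m F z = 0.
Proof.
move=> F0; elim: m z => [|m IHm] z //=.
rewrite -[RHS](circle_integral0 (m.+2)%:R^-1); congr circle_integral.
by apply/funext => w; rewrite IHm.
Qed.

(** A weight function vanishes identically, so chat is the zero fraction. *)
Lemma ccoef_eq0 (R : realType) n i j k l (h : R[i]) : (1 <= l <= n)%N ->
  ~ ((k <= l <= i)%N /\ (l <= j)%N) -> ccoef n i j k l h = 0.
Proof.
move=> hl hn; rewrite /ccoef torus_integral0 ?mulr0// => z.
by rewrite (chat_eq0 R hl hn) fraction_eval0 mul0r.
Qed.

Lemma divr_exprz (F : fieldType) (z : F) (a b : nat) : z != 0 ->
  z ^+ a / z ^+ b = (z ^ (b%:Z - a%:Z))^-1.
Proof.
move=> z0; rewrite expfzDr// -exprnP -invr_expz -exprnP.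
by rewrite invfM invrK mulrC.
Qed.

Theorem proposition4p5 (R : realType) (n i j k l : nat) (h : R[i])
  (hn : (1 <= n)%N)
  (hi : (1 <= i <= n)%N) (hj : (1 <= j <= n)%N)
  (hk : (1 <= k <= n)%N) (hl : (1 <= l <= n)%N) :
  (~ ((k <= l <= i)%N /\ (l <= j)%N) -> ccoef n i j k l h = 0) /\
  ((k < i)%N -> (k <= l <= i)%N -> (i <= j)%N ->
    (l = k ->
      is_residue (fun z : R[i] =>
        h ^+ 2 * (z + h) ^ (i%:Z + j%:Z - k%:Z - 3)
        / z ^ (i%:Z + j%:Z - k%:Z - n%:Z + 1)) 0 (ccoef n i j k l h)) /\
    ((k < l < i)%N ->
      is_residue (fun z : R[i] =>
        h ^+ 3 * (z + h) ^ (i%:Z + j%:Z + k%:Z - 2 * l%:Z - 3)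
        * (z + 2 * h) ^ (l%:Z - k%:Z - 1)
        / z ^ (i%:Z + j%:Z - l%:Z - n%:Z + 1)) 0 (ccoef n i j k l h)) /\
    (l = i ->
      is_residue (fun z : R[i] =>
        h ^ (2 - (i == j)%:Z)
        * (z + h) ^ (k%:Z - 1 + (j%:Z - i%:Z - 1) * (1 - (i == j)%:Z))
        * (z + 2 * h) ^ (i%:Z - k%:Z - 1)
        / z ^ (j%:Z - n%:Z + 1)) 0 (ccoef n i j k l h))) /\
  (k = l -> l = i -> (i <= j)%N ->
    ccoef n i j k l h = if j == n then h ^ (n%:Z - 1) else 0).
Proof.
have [k1 kn] := andP hk; have [j1 jn] := andP hj.
split; first exact: ccoef_eq0.
split=> [ki /andP[kl li] ij|kl li ij]; last first.
  subst k l; rewrite ccoefE// subnn -horner_coef0 horner_ccoef_poly !ltnn.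
  rewrite !add0r subnS subnn expr0 mulr1 addn0 add0n.
  have [->|jn'] := eqVneq j n; last first.
    have nj : (n - j == 0)%N = false by lia.
    by rewrite [0 ^+ (n - j)]expr0n nj /= !mulr0.
  rewrite subnn expr0 mulr1 -exprD.
  have -> : n%:Z - 1 = (n.-1)%:Z by lia.
  by rewrite -exprnP; congr (_ ^+ _); lia.
(* an integer exponent of the statement equals a natural one of the closed
   form by arithmetic on the indices *)
have residue_ccoef (f : R[i] -> R[i]) (Eh Ea Eb Ed : int) :
    Eh = Posz ((l < i)%N + (l < j)%N + (k < l)%N) ->
    Ea = Posz (k.-1 + 2 * (i - l.+1) + (j - maxn i l.+1)) ->
    Eb = Posz (l - k.+1) -> Ed = (i - l)%N.+1%:Z - (n - j)%N%:Z ->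
    (forall z, f z = h ^ Eh * (z + h) ^ Ea * (z + 2 * h) ^ Eb / z ^ Ed) ->
    is_residue f 0 (ccoef n i j k l h).
  move=> EhE EaE EbE EdE fE; rewrite ccoefE//; apply: is_residue_poly => z z0.
  by rewrite fE horner_ccoef_poly EhE EaE EbE EdE -divr_exprz// !mulrA.
split=> [lk|]; last split=> [/andP[kl' li']|li'].
- apply: (residue_ccoef _ 2 (i%:Z + j%:Z - k%:Z - 3) 0
    (i%:Z + j%:Z - k%:Z - n%:Z + 1)) => [||||z]; try lia.
  by rewrite expr0z mulr1 -exprnP.
- apply: (residue_ccoef _ 3 (i%:Z + j%:Z + k%:Z - 2 * l%:Z - 3) (l%:Z - k%:Z -
    1)
    (i%:Z + j%:Z - l%:Z - n%:Z + 1)) => [||||z]; try lia.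
  by rewrite -exprnP.
- apply: (residue_ccoef _ (2 - (i == j)%:Z)
    (k%:Z - 1 + (j%:Z - i%:Z - 1) * (1 - (i == j)%:Z)) (i%:Z - k%:Z - 1)
    (j%:Z - n%:Z + 1)) => [||||z//]; case: (eqVneq i j) => ijE /=; lia.
Qed.
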